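(* For any binary $\mathbb{Z}$-lattice $\ell$, there are infinitely many pairs $(\ell_1,\ell_2)$ of isometry classes of binary $\mathbb{Z}$-lattices such that no quaternary $\mathbb{Z}$-lattice represents $\ell$, $\ell_1$ and $\ell_2$ simultaneously. In particular, $\kappa(2,4)=2$.
   Context: A $\mathbb{Z}$-lattice means a free $\mathbb{Z}$-module of finite rank with a positive definite integer-valued symmetric bilinear form $B$. A $\mathbb{Z}$-lattice $\ell$ is represented by $L$ if there is a linear map $\sigma:\ell\to L$ with $B(\sigma x,\sigma y)=B(x,y)$ for all $x,y\in\ell$. For positive integers $m\le n$, $\kappa(m,n)$ is the largest integer $k$ such that for any $\mathbb{Z}$-lattices $\ell_1,\dots,\ell_k$ of rank $m$ there is a $\mathbb{Z}$-lattice of rank $n$ representing every $\ell_i$. *)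

(* Defs.v *)
From HB Require Import structures.
From mathcomp Require Import all_boot all_order all_algebra.

Set Implicit Arguments.
Unset Strict Implicit.
Unset Printing Implicit Defensive.

Import GRing.Theory Num.Theory.

Local Open Scope ring_scope.

(* [vectType R] only asks [R] to be a nonzero ring: its axiom is a linear
   bijection with ['rV[R]_n], where [n] is recorded as [dim].  Hence a
   [vectType int] is exactly a free Z-module of finite rank [dim].
   [{dot V for idfun}] is the type of symmetric bilinear forms
   [B : V -> V -> int] such that [0 < B x x] for all [x != 0]. *)
Structure zlattice := ZLattice {
  zmodule :> vectType int;
  zform : {dot zmodule for idfun}
}.

Definition rank (L : zlattice) : nat := dim L.

Definition represents (L l : zlattice) : Prop :=
  exists sigma : {linear l -> L},
    forall x y : l, zform L (sigma x) (sigma y) = zform l x y.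

Definition isometric (l l' : zlattice) : Prop :=
  exists sigma : {linear l -> l'},
    bijective sigma /\
    forall x y : l, zform l' (sigma x) (sigma y) = zform l x y.

Definition isometric_pairs (p q : zlattice * zlattice) : Prop :=
  isometric p.1 q.1 /\ isometric p.2 q.2.

(* The objects satisfying [P], taken up to the equivalence relation [E], form
   finitely many (resp. infinitely many) classes.  Classes are counted through
   representatives because [zlattice] lives in too large a universe for
   [set zlattice] and [infinite_set] of mathcomp-classical. *)
Definition finitely_many_up_to (T : Type) (E : T -> T -> Prop)
    (P : T -> Prop) : Prop :=
  exists (n : nat) (s : 'I_n -> T), forall x : T, P x -> exists i, E (s i) x.

Definition infinitely_many_up_to (T : Type) (E : T -> T -> Prop)
    (P : T -> Prop) : Prop :=
  ~ finitely_many_up_to E P.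

Definition simultaneously_representable (m n k : nat) : Prop :=
  forall l : 'I_k -> zlattice, (forall i, rank (l i) = m) ->
    exists L : zlattice, rank L = n /\ forall i, represents L (l i).

(* [is_kappa m n k] reads [kappa (m, n) = k].  It is a relation because the
   existence of a largest [k] is part of the assertion. *)
Definition is_kappa (m n k : nat) : Prop :=
  simultaneously_representable m n k /\
  forall k', simultaneously_representable m n k' -> (k' <= k)%N.

(* Main.v *)
Require Import Defs.
From HB Require Import structures.
From mathcomp Require Import all_boot all_order all_algebra.
From mathcomp Require Import perm finfield.
From mathcomp Require Import zify ring lra.

(** Let [d] be the determinant of [l], let [p] be an odd prime such that [-d] is
a nonresidue modulo [p], and let [l1] be [l] scaled by [p].  Nonzero vectors of
[l] and [l1] never have the same norm, so in a quaternary lattice [L]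
representing both, the two images span a sublattice of rank 4, and the
determinant [D] of [L] is bounded by some [C] depending only on [l] and [p].
The lattice [l2 = <P, P e>] is chosen after [C]: [P] is a product of distinct
primes [q > C] such that every nonsquare [D] with [|D| <= C] is a nonresidue
modulo one of them, [e = -1] modulo [8 C!], and [-e] is a nonresidue modulo
every [q].

If [D] is not a square, take [q] dividing [P] with [D] a nonresidue.  Modulo [q]
the image of [l2] is totally isotropic, hence of rank at most one, since a
totally isotropic plane would make [D] a square; so [q] divides some
[a^2 + e b^2] nontrivially, which is impossible.

If [D] is a square, let [x], [y] span the image of [l2], where [y] is made
primitive by dividing a square out of [e].  For [z] in [L], let [m] be the Gram
determinant of [x], [y], [z] divided by [P].  For a suitable [z], [-m] is a unit
square modulo [e], whereas [-e] is a square modulo every odd prime dividing [m];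
since [m > 0] and [e = 7] modulo 8, this contradicts quadratic reciprocity. *)

Set Implicit Arguments.
Unset Strict Implicit.
Unset Printing Implicit Defensive.

Import VectorInternalTheory.
Import Order.TTheory GRing.Theory Num.Theory.

Local Open Scope ring_scope.

(** * Gram matrices of lattices *)

Definition bform (R : comNzRingType) n (G : 'M[R]_n) (x y : 'rV[R]_n) : R :=
  (x *m G *m y^T) 0 0.

Definition pos_def n (G : 'M[int]_n) : Prop :=
  G^T = G /\ forall x, x != 0 -> 0 < bform G x x.

Section Bform.
Variables (R : comNzRingType) (n : nat) (G : 'M[R]_n).

Lemma bformDl x y z : bform G (x + y) z = bform G x z + bform G y z.
Proof. by rewrite /bform !mulmxDl mxE. Qed.

Lemma bformZl a x y : bform G (a *: x) y = a * bform G x y.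
Proof. by rewrite /bform -!scalemxAl mxE. Qed.

Lemma bformDr x y z : bform G x (y + z) = bform G x y + bform G x z.
Proof. by rewrite /bform linearD mulmxDr mxE. Qed.

Lemma bformZr a x y : bform G x (a *: y) = a * bform G x y.
Proof. by rewrite /bform linearZ -scalemxAr mxE. Qed.

Lemma bformNl x y : bform G (- x) y = - bform G x y.
Proof. by rewrite -scaleN1r bformZl mulN1r. Qed.

Lemma bformNr x y : bform G x (- y) = - bform G x y.
Proof. by rewrite -scaleN1r bformZr mulN1r. Qed.

Lemma bformC x y : G^T = G -> bform G x y = bform G y x.
Proof.
by move=> GT; rewrite /bform -[in LHS]GT -[x in LHS]trmxK -!trmx_mul mxE mulmxA.
Qed.

Lemma bform_mul m (M N : 'M_(m, n)) i j :
  (M *m G *m N^T) i j = bform G (row i M) (row j N).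
Proof. by rewrite /bform -row_mul !mxE; apply: eq_bigr => k _; rewrite !mxE. Qed.

End Bform.

Section GramLattice.
Variables (n : nat) (G : 'M[int]_n).
Hypothesis Gpos : pos_def G.

Definition gram_form (x y : 'rV[int]_n) : int := bform G x y.

Let gram_form_bilinear : bilinear_for *%R (idfun \; *%R) gram_form.
Proof.
split=> [y a x z|x a y z].
  by rewrite /gram_form bformDl bformZl.
by rewrite /gram_form bformDr bformZr.
Qed.

HB.instance Definition _ :=
  @bilinear_isBilinear.Build int _ _ _ *%R (idfun \; *%R) gram_form gram_form_bilinear.

Let gram_form_sym x y : gram_form x y = (-1) ^+ false * idfun (gram_form y x).
Proof. by rewrite mul1r; apply: bformC; case: Gpos. Qed.

HB.instance Definition _ :=
  isHermitianSesquilinear.Build int _ false idfun gram_form gram_form_sym.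

Let gram_form_pos x : x != 0 -> 0 < gram_form x x.
Proof. by case: Gpos => _; apply. Qed.

HB.instance Definition _ :=
  isDotProduct.Build int _ gram_form gram_form_pos.

Definition gram_lattice : zlattice := @ZLattice 'rV[int]_n gram_form.

End GramLattice.

Lemma rank_gram_lattice n (G : 'M[int]_n) (Gpos : pos_def G) :
  rank (gram_lattice Gpos) = n.
Proof. by rewrite /rank /= /dim /= mul1n. Qed.

(** [f] reads off coordinates in a basis of [L], so [G] is the Gram matrix of [L] in that basis; the
    basis itself stays implicit. *)
Definition gram_of n (L : zlattice) (G : 'M[int]_n) : Prop :=
  exists (f : {linear L -> 'rV[int]_n}) (g : {linear 'rV[int]_n -> L}),
    [/\ cancel f g, cancel g f
      & forall x y : L, zform L x y = bform G (f x) (f y)].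

Lemma bformE n (R : comNzRingType) (G : 'M[R]_n) x y :
  bform G x y = \sum_i \sum_j x 0 i * y 0 j * G i j.
Proof.
rewrite /bform mxE exchange_big; apply: eq_bigr => j _ /=.
rewrite !mxE mulr_suml; apply: eq_bigr => i _.
by rewrite mulrAC.
Qed.

Lemma bform_delta n (R : comNzRingType) (G : 'M[R]_n) i j :
  bform G (delta_mx 0 i) (delta_mx 0 j) = G i j.
Proof. by rewrite /bform -rowE trmx_delta -colE !mxE. Qed.

Lemma gram_of_exists n (L : zlattice) :
  rank L = n -> exists G : 'M[int]_n, gram_of L G.
Proof.
move=> <-.
pose f : {linear L -> 'rV[int]_(dim L)} :=
  @v2r int L.
pose g : {linear 'rV[int]_(dim L) -> L} :=
  @r2v int L.
have fK : cancel f g by exact: v2rK.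
exists (\matrix_(i, j) zform L (g (delta_mx 0 i)) (g (delta_mx 0 j))).
exists f, g; split=> // [|x y]; first exact: r2vK.
rewrite bformE -{1}(fK x) -{1}(fK y).
rewrite [in LHS](row_sum_delta (f x)) linear_sum linear_sumlz.
apply: eq_bigr => i _.
rewrite linearZ linearZl_LR /= [in LHS](row_sum_delta (f y)) linear_sum.
rewrite linear_sumr mulr_sumr.
apply: eq_bigr => j _.
by rewrite linearZ linearZr_LR /= mxE mulrA.
Qed.

Lemma gram_of_lattice n (G : 'M[int]_n) (Gpos : pos_def G) :
  gram_of (gram_lattice Gpos) G.
Proof.
by exists (idfun : {linear 'rV[int]_n -> 'rV[int]_n}),
  (idfun : {linear 'rV[int]_n -> 'rV[int]_n}).
Qed.

Lemma gram_pos_def n (L : zlattice) (G : 'M[int]_n) : gram_of L G -> pos_def G.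
Proof.
case=> f [g [fK gK fE]]; split=> [|x nzx].
  have GE u v : bform G u v = zform L (g u) (g v) by rewrite fE !gK.
  apply/matrixP=> i j; rewrite mxE -!(bform_delta G) !GE hermC.
  by rewrite expr0 mul1r.
rewrite -(gK x) -fE neq0_dnorm_gt0 //.
by apply: contraNneq nzx => gx0; rewrite -(gK x) gx0 linear0.
Qed.

(** The rows of [S] are the coordinates of the images of the basis vectors of [l]. *)
Lemma represents_gram m n (L l : zlattice) (G : 'M[int]_n) (A : 'M[int]_m) :
  gram_of L G -> gram_of l A ->
  represents L l <-> exists S : 'M[int]_(m, n), A = S *m G *m S^T.
Proof.
case=> f [g [fK gK fE]] [f' [g' [fK' gK' fE']]]; split=> [[s sE]|[S AE]].
  exists (\matrix_i f (s (g' (delta_mx 0 i)))).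
  apply/matrixP=> i j; rewrite bform_mul !rowK -fE sE fE' !gK'.
  by rewrite bform_delta.
pose h (x : l) : L := g (f' x *m S).
have hlin : linear h.
  by move=> a x y; rewrite /h linearP mulmxDl -scalemxAl linearP.
pose hM := GRing.isLinear.Build int l L _ h hlin.
exists (HB.pack_for {linear l -> L} h hM) => x y /=.
by rewrite fE fE' /h !gK AE /bform trmx_mul !mulmxA.
Qed.

(** * Quadratic reciprocity and the Jacobi symbol *)

(* [p./2] is [(p - 1) / 2] for odd [p]; the value at [p = 2] is junk. *)
Definition legendre (a : int) (p : nat) : int :=
  let u : 'F_p := a%:~R in
  if u == 0 then 0 else if u ^+ p./2 == 1 then 1 else -1.

Section Legendre.
Variable p : nat.
Hypotheses (p_prime : prime p) (p_odd : odd p).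
Let h := p./2.

Lemma Fp_intr_eq0 q (a : int) : prime q -> ((a%:~R : 'F_q) == 0) = (q %| `|a|)%N.
Proof.
move=> qp; have E (n : nat) : ((n%:R : 'F_q) == 0) = (q %| n)%N.
  by rewrite (dvdn_pcharf (pchar_Fp qp)).
by case: a => n; rewrite ?NegzE ?mulrNz ?oppr_eq0 -?pmulrn E // abszN.
Qed.

Lemma Fp_fermat (u : 'F_p) : u != 0 -> u ^+ h ^+ 2 = 1.
Proof.
move=> u0; rewrite -exprM.
have -> : (h * 2 = p.-1)%N by have := prime_gt1 p_prime; rewrite /h; lia.
have := expf_card u; rewrite card_Fp //.
have -> : u ^+ p = u * u ^+ p.-1 by rewrite -exprS prednK // prime_gt0.
by move/(canRL (mulKf u0)); rewrite mulVf.
Qed.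

Lemma legendreE a : (legendre a p)%:~R = (a%:~R : 'F_p) ^+ h.
Proof.
rewrite /legendre; case: eqVneq => [->|u0].
  by rewrite expr0n; have := prime_gt1 p_prime; rewrite /h; case: p p_odd => [|[|[|]]].
have /eqP := Fp_fermat u0; rewrite -/h.
by rewrite sqrf_eq1; case: eqVneq => [->|] //= _ /eqP ->.
Qed.

Lemma Fp_oneN1 : (1 : 'F_p) != -1.
Proof.
rewrite -subr_eq0 opprK -[1 + 1]/(2%:R) -(dvdn_pcharf (pchar_Fp p_prime)).
apply/negP=> /(dvdn_leq (ltn0Sn _)); have := prime_gt1 p_prime.
by move: p_odd; lia.
Qed.

(** For odd [p] the residues of 0, 1 and -1 are distinct, so by Euler's criterion an identity
    between symbols can be checked in ['F_p]. *)
Lemma legendre_eq (a s : int) :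
  s \in [:: 0; 1; -1] -> s%:~R = (a%:~R : 'F_p) ^+ h -> legendre a p = s.
Proof.
rewrite -legendreE.
have : legendre a p \in [:: 0; 1; -1].
  by rewrite /legendre; case: ifP => // _; case: ifP.
have n1 := oner_neq0 'F_p; have nn := Fp_oneN1.
rewrite !inE => /or3P[] /eqP-> /or3P[] /eqP-> //;
  rewrite ?(rmorph0, rmorph1, rmorphN1) => /eqP;
  by rewrite ?(eq_sym 0) ?oppr_eq0 ?(eq_sym (- 1)) ?(negPf n1) ?(negPf nn).
Qed.

Lemma legendre_mem a : legendre a p \in [:: 0; 1; -1].
Proof. by rewrite /legendre; case: ifP => // _; case: ifP. Qed.

Lemma legendreM a b : legendre (a * b) p = legendre a p * legendre b p.
Proof.
apply: legendre_eq; last by rewrite !intrM exprMn -!legendreE.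
by have := legendre_mem a; have := legendre_mem b;
   rewrite !inE => /or3P[] /eqP-> /or3P[] /eqP->.
Qed.

Lemma legendre_sqr (x : 'F_p) a : x ^+ 2 = a%:~R -> x != 0 -> legendre a p = 1.
Proof.
move=> xa x0; apply: legendre_eq => //.
by rewrite -xa exprAC Fp_fermat.
Qed.

Lemma legendreN1 : legendre (-1) p = (-1) ^+ h.
Proof.
apply: legendre_eq; last by rewrite rmorphXn.
by rewrite -signr_odd !inE; case: odd.
Qed.

(** The polynomial ['X^h - 1] has at most (p - 1) / 2 roots, fewer than the p - 1 nonzero
    residues. *)
Lemma exists_nonresidue : exists r : nat, legendre r p = -1.
Proof.
have h0 : (0 < h)%N by have := prime_gt1 p_prime; move: p_odd; rewrite /h; lia.
case: (pickP (fun u : 'F_p => (u != 0) && (u ^+ h != 1))) => [u /andP[u0 u1]|H].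
  by exists u; rewrite /legendre -pmulrn natr_Zp (negPf u0) -/h (negPf u1).
have : (size (enum [pred u : 'F_p | (u != 0)%R]) < size ('X^h - 1 : {poly 'F_p})%R)%N.
apply: max_poly_roots.
- by rewrite -size_poly_eq0 size_XnsubC.
- apply/allP=> u; rewrite mem_enum inE => u0.
  move: (H u); rewrite /= u0 /= => /negbFE /eqP uh.
  by rewrite rootE !hornerE uh subrr.
- exact: enum_uniq.
rewrite size_XnsubC // -cardE ltnS.
have -> : #|[pred u : 'F_p | u != 0]| = p.-1.
  by rewrite -(@eq_card _ (predC1 0)) // cardC1 card_Fp.
by move=> ?; have := prime_gt1 p_prime; move: p_odd; rewrite /h; lia.
Qed.

(** * Gauss's lemma and quadratic reciprocity *)

Section Gauss.
Variable a : nat.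
Hypothesis pa : ~~ (p %| a)%N.

(** Together with [neg_residue], this is the absolute value and the sign of the residue of [a * k]
    that lies between [-h] and [h]. *)
Definition abs_residue k := let r := ((a * k) %% p)%N in if (r <= h)%N then r else (p - r)%N.
Definition neg_residue k : bool := (h < (a * k) %% p)%N.

Lemma abs_residueE k :
  ((a * k)%:R : 'F_p) = (-1) ^+ neg_residue k * (abs_residue k)%:R.
Proof.
have Er : ((a * k)%:R : 'F_p) = ((a * k) %% p)%:R.
  by rewrite {1}(divn_eq (a * k) p) natrD natrM pchar_Fp_0 ?mulr0 ?add0r.
rewrite Er /neg_residue /abs_residue; case: leqP => _; first by rewrite mul1r.
rewrite natrB; last by rewrite ltnW // ltn_mod prime_gt0.
by rewrite pchar_Fp_0 // sub0r mulN1r opprK.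
Qed.

Lemma abs_residue_range k : (1 <= k < h.+1)%N -> (1 <= abs_residue k < h.+1)%N.
Proof.
move=> kh; have r0 : ((a * k) %% p != 0)%N.
  rewrite -/(dvdn p (a * k)) Euclid_dvdM // (negPf pa) /=.
  by apply/negP => /dvdn_leq; move: kh; rewrite /h; lia.
have := ltn_pmod (a * k) (prime_gt0 p_prime).
rewrite /abs_residue /=; set r := ((a * k) %% p)%N in r0 *.
by move=> rp; case: (leqP r h); move: p_odd; rewrite /h; lia.
Qed.

(** If [a * k] and [a * l] agree up to sign modulo [p], so do [k] and [l]; since [0 < k + l < p],
    this forces [k = l]. An injective map of [1..h] into itself is a permutation. *)
Lemma perm_abs_residue :
  perm_eq [seq abs_residue k | k <- index_iota 1 h.+1] (index_iota 1 h.+1).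
Proof.
have inj : {in index_iota 1 h.+1 &, injective abs_residue}.
  move=> k l; rewrite !mem_index_iota => kh lh E.
  have a0 : (a%:R : 'F_p) != 0 by rewrite -(dvdn_pcharf (pchar_Fp p_prime)).
  have := abs_residueE l; have := abs_residueE k; rewrite E.
  set s := ((abs_residue l)%:R : 'F_p) => Ek El.
  have : (k%:R : 'F_p) = l%:R \/ (k%:R : 'F_p) = - l%:R.
    have [|] : (a%:R * k%:R : 'F_p) = a%:R * l%:R \/ (a%:R * k%:R : 'F_p) = - (a%:R * l%:R).
      rewrite -!natrM Ek El; case: (neg_residue k); case: (neg_residue l);
      rewrite ?expr0 ?expr1 ?mulN1r ?mul1r ?opprK; by [left|right].
    - by move/(mulfI a0); left.
    by rewrite -mulrN => /(mulfI a0); right.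
  case=> /eqP; clear s Ek El.
    rewrite eq_sym -subr_eq0; wlog : k l kh lh E / (k <= l)%N => [H|kl].
      case/orP: (leq_total k l) => [|lk]; first exact: H.
      by rewrite -oppr_eq0 opprB => /(H l k lh kh (esym E) lk).
    rewrite -natrB // -(dvdn_pcharf (pchar_Fp p_prime)) => /dvdn_leq.
    by move: kh lh; rewrite /h; lia.
  rewrite -addr_eq0 -natrD -(dvdn_pcharf (pchar_Fp p_prime)) => /dvdn_leq.
  by move: kh lh; rewrite /h; lia.
apply: uniq_perm; [by rewrite map_inj_in_uniq ?iota_uniq | exact: iota_uniq |].
apply: (uniq_min_size _ _ _).2; last by rewrite size_map.
  by rewrite map_inj_in_uniq ?iota_uniq.
move=> x /mapP[k]; rewrite !mem_index_iota => kh ->.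
exact: abs_residue_range.
Qed.

(** Multiply the congruences of [abs_residueE] over [k] in [1..h] and cancel the factorial of [h],
    which is a unit modulo [p]. *)
Lemma gauss_lemma :
  legendre a p = (-1) ^+ odd (\sum_(1 <= k < h.+1) neg_residue k).
Proof.
apply: legendre_eq; first by case: odd.
rewrite signr_odd rmorphXn /=.
have nz : \prod_(1 <= k < h.+1) (k%:R : 'F_p) != 0.
  rewrite prodf_seq_neq0; apply/allP => k; rewrite mem_index_iota => kh.
  rewrite -(dvdn_pcharf (pchar_Fp p_prime)); apply/negP => /dvdn_leq.
  by move: kh; rewrite /h; lia.
apply: (mulIf nz).
have -> : (a%:~R : 'F_p) ^+ h * \prod_(1 <= k < h.+1) (k%:R : 'F_p) =
   \prod_(1 <= k < h.+1) ((a * k)%:R : 'F_p).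
  under [RHS]eq_bigr do rewrite natrM.
  by rewrite big_split /= prodr_const_nat subSS subn0 -pmulrn.
under [RHS]eq_bigr do rewrite abs_residueE.
rewrite big_split /= -(big_map abs_residue xpredT (fun k => k%:R)) /=.
rewrite (perm_big _ perm_abs_residue) /= rmorphN1; congr (_ * _).
by rewrite (big_morph (fun k => (-1) ^+ k) (exprD (-1 : 'F_p)) (expr0 _)).
Qed.

(** With [a] and [p] odd, [a * k = d * p + r] gives [k = d + r] modulo 2, and passing from [r] to
    [p - r] changes the parity. After summation, the [k] and their absolute residues cancel because
    the latter are a permutation of the former. *)
Lemma eisenstein_lemma : odd a ->
  odd (\sum_(1 <= k < h.+1) neg_residue k) = odd (\sum_(1 <= k < h.+1) (a * k) %/ p).
Proof.
move=> a_odd; pose O := big_morph odd oddD (erefl : odd 0 = false).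
have E1 : odd (\sum_(1 <= k < h.+1) k) = odd (\sum_(1 <= k < h.+1) abs_residue k).
  by rewrite -(perm_big _ perm_abs_residue) big_map.
have E2 : odd (\sum_(1 <= k < h.+1) abs_residue k) =
  odd (\sum_(1 <= k < h.+1) k) (+) odd (\sum_(1 <= k < h.+1) (a * k) %/ p)
  (+) odd (\sum_(1 <= k < h.+1) neg_residue k).
  rewrite !O -!big_split /=; apply: eq_bigr => k _.
  have := divn_eq (a * k) p; have := ltn_pmod (a * k) (prime_gt0 p_prime).
  rewrite /abs_residue /neg_residue.
  set d := ((a * k) %/ p)%N; set r := ((a * k) %% p)%N => rp /(congr1 odd).
  rewrite oddM oddD oddM a_odd p_odd /= andbT => ->.
  case: leqP => _; first by rewrite addbF addbAC addbb.
  rewrite oddB ?(ltnW rp) // p_odd.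
  by case: (odd d); case: (odd r).
by move: E2; rewrite -E1; case: (odd (\sum_(1 <= k < _) k)); do 2!case: odd.
Qed.

End Gauss.
End Legendre.

Lemma sum_nat_leq n N : (n <= N)%N -> (\sum_(1 <= j < N.+1) (j <= n) = n)%N.
Proof.
move=> nN; rewrite (@big_cat_nat _ _ _ n.+1) //= [X in (_ + X)%N]big1_seq ?addn0.
  rewrite (eq_big_nat _ _ (F2 := fun=> 1%N)).
    by rewrite sum_nat_const_nat muln1 subSS subn0.
  by move=> i /andP[_]; rewrite ltnS => ->.
move=> i /andP[_]; rewrite mem_index_iota => /andP[ni _].
by rewrite leqNgt ni.
Qed.

(** The sums count the points (k, j) of a [p./2] by [q./2] rectangle on the two sides of the line
    [p * j = q * k]. No point lies on the line, since [p] divides neither [q] nor [k]. *)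
Lemma eisenstein_count p q : prime p -> prime q -> odd p -> odd q -> p != q ->
  (\sum_(1 <= k < p./2.+1) (q * k) %/ p + \sum_(1 <= j < q./2.+1) (p * j) %/ q
    = p./2 * q./2)%N.
Proof.
move=> pp qp po qo pq; have p0 := prime_gt0 pp; have q0 := prime_gt0 qp.
have count a b k : (0 < a)%N -> (0 < b)%N -> odd a -> odd b -> (k < a./2.+1)%N ->
    ((b * k) %/ a = \sum_(1 <= j < b./2.+1) (a * j <= b * k))%N.
  move=> a0 b0 ao bo kh.
  rewrite -[LHS](@sum_nat_leq _ b./2).
    by apply: eq_bigr => j _; rewrite leq_divRL // mulnC.
  rewrite -ltnS ltn_divLR //; move: kh => /=; nia.
rewrite (eq_big_nat _ _ (F2 := fun k => \sum_(1 <= j < q./2.+1) (p * j <= q * k))%N);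
  last by move=> k /andP[_]; apply: count.
rewrite [X in (_ + X)%N](eq_big_nat _ _
  (F2 := fun j => \sum_(1 <= k < p./2.+1) (q * k <= p * j))%N);
  last by move=> k /andP[_]; apply: count.
rewrite [X in (_ + X)%N]exchange_big -big_split /=.
rewrite (eq_big_nat _ _ (F2 := fun k => q./2)).
  by rewrite sum_nat_const_nat subSS subn0.
move=> k /andP[k0 kh]; rewrite -big_split /=.
rewrite (eq_big_nat _ _ (F2 := fun j => 1%N)).
  by rewrite sum_nat_const_nat subSS subn0 muln1.
move=> j _; case: (ltngtP (p * j) (q * k)) => //= E.
have : (p %| q * k)%N by rewrite -E dvdn_mulr.
rewrite Euclid_dvdM // dvdn_prime2 // (negPf pq) /= => /dvdn_leq.
by move: kh; lia.
Qed.

Lemma quadratic_reciprocity p q : prime p -> prime q -> odd p -> odd q -> p != q ->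
  legendre p q * legendre q p = (-1) ^+ (p./2 * q./2).
Proof.
move=> pp qp po qo pq.
have ndvd a b : prime a -> prime b -> a != b -> ~~ (b %| a)%N.
  by move=> ap bp ab; rewrite dvdn_prime2 // eq_sym.
rewrite (gauss_lemma qp qo) ?ndvd // (gauss_lemma pp po) ?ndvd // 1?eq_sym //.
rewrite !eisenstein_lemma ?ndvd // 1?eq_sym // -signr_addb -oddD.
by rewrite addnC eisenstein_count // signr_odd.
Qed.

(** For [k <= p./2] the product [2 * k] is its own residue, so Gauss's lemma counts the [k] above
    half of [p./2]. For odd [p] the truncated quotient in the exponent is (p^2 - 1) / 8. *)
Lemma legendre2 p : prime p -> odd p -> legendre 2 p = (-1) ^+ ((p * p) %/ 8).
Proof.
move=> pp po; rewrite (gauss_lemma pp po (a := 2)); last first.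
  by rewrite dvdn_prime2 //; apply: contraL po => /eqP ->.
have -> : (\sum_(1 <= k < p./2.+1) neg_residue p 2 k = p./2 - p./2./2)%N.
  have E : (\sum_(1 <= k < p./2.+1) neg_residue p 2 k
      + \sum_(1 <= k < p./2.+1) (k <= p./2./2) = p./2)%N.
    rewrite -big_split /= (eq_big_nat _ _ (F2 := fun k => 1%N)).
      by rewrite sum_nat_const_nat subSS subn0 muln1.
    move=> k kh; rewrite /neg_residue modn_small; last by lia.
    by case: ltnP; case: leqP; lia.
  by move: E; rewrite sum_nat_leq; lia.
rewrite -[RHS]signr_odd; congr (_ ^+ (nat_of_bool _)).
have sq_div8 x y : (x = 8 * y + 1 -> x %/ 8 = y)%N.
  by move=> ->; rewrite mulnC divnMDl // addn0.
have Ep : p = (p./2).*2.+1 by rewrite -[LHS]odd_double_half po.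
have Eh := odd_double_half p./2; set h := p./2 in Ep Eh *; set t := h./2 in Eh *.
case: (odd h) Eh => Eh.
  rewrite (sq_div8 _ (2 * (t * t + t) + t.+1)%N); last by rewrite Ep; nia.
  have -> : (h - t = t.+1)%N by lia.
  by rewrite oddD oddM.
rewrite (sq_div8 _ (2 * (t * t) + t)%N); last by rewrite Ep; nia.
have -> : (h - t = t)%N by lia.
  by rewrite oddD oddM.
Qed.

(** * The Jacobi symbol *)

Definition jacobi (a : int) (n : nat) : int :=
  \prod_(0 <= p < n.+1 | prime p) legendre a p ^+ logn p n.

Lemma jacobi_widen a n N : (0 < n)%N -> (n <= N)%N ->
  jacobi a n = \prod_(0 <= p < N.+1 | prime p) legendre a p ^+ logn p n.
Proof.
move=> n0 nN; rewrite /jacobi (@big_cat_nat _ _ _ n.+1 0 N.+1) //=.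
rewrite [X in _ = _ * X]big1_seq ?mulr1 // => p /andP[pp].
rewrite mem_index_iota => /andP[np _].
by rewrite lognE pp n0 /= gtnNdvd.
Qed.

Lemma jacobiMr a m n : (0 < m)%N -> (0 < n)%N ->
  jacobi a (m * n) = jacobi a m * jacobi a n.
Proof.
move=> m0 n0; rewrite (@jacobi_widen a m (m * n)) ?leq_pmulr //.
rewrite (@jacobi_widen a n (m * n)) ?leq_pmull // -big_split /=.
by apply: eq_bigr => p pp; rewrite lognM // exprD.
Qed.

Lemma jacobi1 a : jacobi a 1 = 1.
Proof. by rewrite /jacobi big1_seq // => p _; rewrite logn1. Qed.

Lemma jacobi_prime a p : prime p -> jacobi a p = legendre a p.
Proof.
move=> pp; rewrite /jacobi big_mkcond big_nat_recr //= pp logn_prime // eqxx expr1.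
rewrite big1_seq ?mul1r // => q; rewrite mem_index_iota => /andP[_ qp'].
by rewrite logn_prime // (ltn_eqF qp'); case: ifP.
Qed.

(** Peeling off one prime factor at a time carries each law of the Legendre symbol over to the
    Jacobi symbol. *)
Lemma odd_nat_ind (P : nat -> Prop) :
  P 1%N -> (forall p m, prime p -> odd p -> odd m -> P m -> P (p * m)%N) ->
  forall n, odd n -> P n.
Proof.
move=> P1 PM; elim/ltn_ind => n IH no.
have [->//|n1] := eqVneq n 1%N.
have n2 : (1 < n)%N by case: n no n1 {IH} => [|[]].
have E : n = (pdiv n * (n %/ pdiv n))%N by rewrite mulnC divnK ?pdiv_dvd.
move: (no); rewrite {1}E oddM => /andP[po mo].
rewrite E; apply: PM => //; first exact: pdiv_prime.
apply: IH => //; rewrite ltn_Pdiv ?prime_gt1 ?pdiv_prime //; exact: ltnW.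
Qed.

Lemma jacobiMl a b n : odd n -> jacobi (a * b) n = jacobi a n * jacobi b n.
Proof.
move: n; apply: odd_nat_ind => [|p m pp po mo IH]; first by rewrite !jacobi1.
have m0 := odd_gt0 mo; have p0 := prime_gt0 pp.
rewrite !jacobiMr // IH !(jacobi_prime _ pp) legendreM //; ring.
Qed.

Lemma jacobi_modr (a b : int) n :
  odd n -> (n %| `|a - b|)%N -> jacobi a n = jacobi b n.
Proof.
move: n; apply: odd_nat_ind => [|p m pp po mo IH]; first by rewrite !jacobi1.
move=> pmd; rewrite !jacobiMr ?odd_gt0 // IH ?(dvdn_trans _ pmd) ?dvdn_mull //.
rewrite !(jacobi_prime _ pp) /legendre.
suff -> : (a%:~R : 'F_p) = b%:~R by [].
apply/eqP; rewrite -subr_eq0 -intrB Fp_intr_eq0 //.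
by rewrite (dvdn_trans _ pmd) ?dvdn_mulr.
Qed.

Lemma jacobi_sqr (a : int) n : odd n -> coprime `|a| n -> jacobi (a ^+ 2) n = 1.
Proof.
move: n; apply: odd_nat_ind => [|p m pp po mo IH]; first by rewrite !jacobi1.
rewrite coprimeMr => /andP[ap am].
rewrite !jacobiMr ?odd_gt0 // IH // mulr1 (jacobi_prime _ pp) //.
apply: (legendre_sqr pp po (x := a%:~R)); first by rewrite rmorphXn.
by rewrite Fp_intr_eq0 // -prime_coprime // coprime_sym.
Qed.

Lemma jacobi1l n : odd n -> jacobi 1 n = 1.
Proof.
by move=> no; have := @jacobi_sqr 1 n no (coprime1n n); rewrite expr1n.
Qed.

Lemma jacobi_sign (a : int) n : odd n -> coprime `|a| n -> jacobi a n ^+ 2 = 1.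
Proof. by move=> no an; rewrite expr2 -jacobiMl // -expr2 jacobi_sqr. Qed.

Lemma jacobiN1 n : odd n -> jacobi (-1) n = (-1) ^+ n./2.
Proof.
move: n; apply: odd_nat_ind => [|p m pp po mo IH]; first by rewrite !jacobi1.
rewrite !jacobiMr ?odd_gt0 // IH (jacobi_prime _ pp) // legendreN1 // -exprD.
rewrite -[LHS]signr_odd -[RHS]signr_odd; congr (_ ^+ (nat_of_bool _)).
have -> : ((p * m)./2 = 2 * (p./2 * m./2) + (p./2 + m./2))%N by nia.
by rewrite [RHS]oddD oddM.
Qed.

Lemma jacobi2 n : odd n -> jacobi 2 n = (-1) ^+ ((n * n) %/ 8).
Proof.
move: n; apply: odd_nat_ind => [|p m pp po mo IH]; first by rewrite !jacobi1.
rewrite !jacobiMr ?odd_gt0 // IH (jacobi_prime _ pp) // legendre2 // -exprD.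
rewrite -[LHS]signr_odd -[RHS]signr_odd; congr (_ ^+ (nat_of_bool _)).
have sq8 x : odd x -> (x * x = (x * x) %/ 8 * 8 + 1)%N.
  move=> xo; rewrite {1}(divn_eq (x * x) 8); congr (_ + _)%N.
  rewrite -modnMm; have := ltn_pmod x (isT : (0 < 8)%N).
  have : odd (x %% 8) by rewrite (odd_mod x (erefl : odd 8 = false)).
  by move: (x %% 8)%N => [|[|[|[|[|[|[|[|]]]]]]]].
have := sq8 _ po; have := sq8 _ mo; have : odd (p * m) by rewrite oddM po.
move/sq8; set u := ((p * p) %/ 8)%N; set v := ((m * m) %/ 8)%N.
set w := (_ %/ 8)%N => Ew Ev Eu.
have -> : (w = 2 * (4 * (u * v)) + (u + v))%N.
  have : (p * m * (p * m) = (u * 8 + 1) * (v * 8 + 1))%N by rewrite -Eu -Ev mulnACA.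
  by rewrite Ew; nia.
by rewrite [RHS]oddD oddM.
Qed.

Lemma jacobi_reciprocity a b : odd a -> odd b -> coprime a b ->
  jacobi a b * jacobi b a = (-1) ^+ (a./2 * b./2).
Proof.
(* Modulo 2, halving turns products of odd numbers into sums, so the exponents add up in both
   inductions: first over one argument with the other one prime, then over the other argument. *)
have half p m : odd p -> odd m -> ((p * m)./2 = 2 * (p./2 * m./2) + (p./2 + m./2))%N.
  by move=> po mo; nia.
have main c : odd c -> forall p, prime p -> odd p -> coprime c p ->
    jacobi c p * jacobi p c = (-1) ^+ (c./2 * p./2).
  move: c; apply: odd_nat_ind => [|q m qp qo mo IH] p pp po.
    by rewrite jacobi1 mulr1 mul0n expr0 => _; rewrite jacobi1l.
  rewrite coprimeMl => /andP[cqp cmp].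
  rewrite PoszM jacobiMl // jacobiMr ?odd_gt0 // mulrACA IH //.
  rewrite !(jacobi_prime _ pp) !(jacobi_prime _ qp) quadratic_reciprocity //; last first.
    by apply: contraL cqp => /eqP ->; rewrite /coprime gcdnn neq_ltn (prime_gt1 pp) orbT.
  rewrite -exprD -[LHS]signr_odd -[RHS]signr_odd; congr (_ ^+ (nat_of_bool _)).
  by rewrite half // [in RHS]mulnDl -mulnA [RHS]oddD oddM /= mulnDl.
move=> ao; move: b; apply: odd_nat_ind => [|q m qp qo mo IH].
  by rewrite jacobi1 mul1r muln0 expr0 => _; rewrite jacobi1l.
rewrite coprimeMr => /andP[cqp cmp].
rewrite PoszM jacobiMl // jacobiMr ?odd_gt0 // mulrACA IH //.
rewrite main // -exprD -[LHS]signr_odd -[RHS]signr_odd; congr (_ ^+ (nat_of_bool _)).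
by rewrite half // [in RHS]mulnDr mulnCA [RHS]oddD oddM /= mulnDr.
Qed.

(** A product of symbols can be -1 only if one factor is -1. Nonresidue primes are produced in this
    way, as factors of an integer whose Jacobi symbol is known. *)
Lemma jacobi_eqN1 (a : int) n : odd n -> jacobi a n = -1 ->
  exists p : nat, [/\ prime p, odd p, (p %| n)%N & legendre a p = -1].
Proof.
move: n; apply: odd_nat_ind => [|p m pp po mo IH]; first by rewrite jacobi1.
rewrite jacobiMr ?odd_gt0 // (jacobi_prime _ pp).
have := legendre_mem p a; rewrite !inE => /or3P[] /eqP ap; rewrite ap.
- by rewrite mul0r.
- rewrite mul1r => /IH[q [qp qo qm aq]]; exists q; split=> //.
  exact: dvdn_mull.
by move=> _; exists p; split=> //; exact: dvdn_mulr.
Qed.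

Lemma jacobi_eq1 (a : int) n : odd n ->
  (forall p : nat, prime p -> odd p -> (p %| n)%N -> legendre a p = 1) ->
  jacobi a n = 1.
Proof.
move: n; apply: odd_nat_ind => [|p m pp po mo IH H]; first by rewrite jacobi1.
rewrite jacobiMr ?odd_gt0 // (jacobi_prime _ pp) H ?dvdn_mulr // mul1r.
by apply: IH => q qp qo qm; apply: H => //; exact: dvdn_mull.
Qed.

Lemma jacobi2_1mod8 n : (n %% 8 = 1)%N \/ (n %% 8 = 7)%N -> jacobi 2 n = 1.
Proof.
move=> H; have E := divn_eq n 8; set t := (n %/ 8)%N in E.
rewrite jacobi2; last by rewrite E oddD oddM; case: H => ->; rewrite andbF.
rewrite -signr_odd; case: H E => -> ->.
  have -> : ((t * 8 + 1) * (t * 8 + 1) = (2 * (4 * (t * t) + t)) * 8 + 1)%N by ring.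
  by rewrite divnMDl // addn0 oddM.
have -> : ((t * 8 + 7) * (t * 8 + 7) = (2 * (4 * (t * t) + 7 * t + 3)) * 8 + 1)%N by ring.
by rewrite divnMDl // addn0 oddM.
Qed.

Lemma jacobi2_5mod8 n : (n %% 8 = 5)%N -> jacobi 2 n = -1.
Proof.
move=> H; have E := divn_eq n 8; set t := (n %/ 8)%N in E.
rewrite jacobi2; last by rewrite E oddD oddM H andbF.
rewrite -signr_odd E H.
have -> : ((t * 8 + 5) * (t * 8 + 5) = (2 * (4 * (t * t) + 5 * t + 1) + 1) * 8 + 1)%N by ring.
by rewrite divnMDl // addn0 oddD oddM.
Qed.

Lemma jacobi_exp (a : int) i n : odd n -> jacobi (a ^+ i) n = jacobi a n ^+ i.
Proof.
move=> no; elim: i => [|i IH]; first by rewrite !expr0 jacobi1l.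
by rewrite !exprS jacobiMl // IH.
Qed.

Lemma odd_part n : (0 < n)%N -> exists i m, odd m /\ n = (2 ^ i * m)%N.
Proof.
elim/ltn_ind: n => n IH n0; case/boolP: (odd n) => no.
  by exists 0%N, n; rewrite mul1n.
have En : n = (2 * n./2)%N by rewrite mul2n -[LHS]odd_double_half (negPf no).
have [||i [m [mo Em]]] := IH n./2; [by lia | by lia|].
by exists i.+1, m; rewrite mo expnS -mulnA -Em.
Qed.

Lemma jacobi_flip a b : odd a -> odd b -> coprime a b ->
  jacobi a b = (-1) ^+ (a./2 * b./2) * jacobi b a.
Proof.
move=> ao bo ab; rewrite -jacobi_reciprocity // -mulrA -expr2 jacobi_sign ?mulr1 //.
by rewrite coprime_sym.
Qed.

Lemma jacobi_flip_1mod4 a b : odd a -> (b %% 4 = 1)%N -> coprime a b ->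
  jacobi a b = jacobi b a.
Proof.
move=> ao b4 ab; have bo : odd b by lia.
rewrite jacobi_flip // -signr_odd oddM.
have -> : odd b./2 = false by lia.
by rewrite andbF mul1r.
Qed.

Lemma jacobi_mod1 n d : odd d -> (0 < n)%N -> n = 1 %[mod d] -> jacobi n d = 1.
Proof.
move=> od n0 nd; rewrite (@jacobi_modr _ 1) ?jacobi1l //.
have -> : (`|n%:Z - 1| = n - 1)%N by lia.
by rewrite -eqn_mod_dvd //; apply/eqP.
Qed.

(** As [n] is 1 modulo 8, both the symbol of 2 and the reciprocity sign are trivial; flipping the
    odd part [m] of [d] leaves the symbol of [n] modulo [m], where [n] is 1. *)
Lemma jacobi_1mod d n : (0 < d)%N -> (n %% 8 = 1)%N -> n = 1 %[mod d] ->
  jacobi d n = 1.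
Proof.
move=> d0 n8 nd; have no : odd n by lia.
have [i [m [mo Ed]]] := odd_part d0.
have nm : n = 1 %[mod m].
  by move/(congr1 (modn^~ m)): nd; rewrite Ed !modn_dvdm ?dvdn_mull.
have mn : coprime m n by rewrite coprime_sym -coprime_modl nm coprime_modl coprime1n.
rewrite Ed PoszM jacobiMl // -[Posz (2 ^ i)]natz natrX jacobi_exp //.
rewrite jacobi2_1mod8; last by left.
rewrite expr1n mul1r jacobi_flip_1mod4 //; last by lia.
by rewrite jacobi_mod1 ?odd_gt0.
Qed.

(** Here [n./2] is odd, so flipping the odd part [m] of [d] costs the sign [(-1) ^+ m./2]. This
    cancels the symbol of [n] modulo [m], which is that of -1. *)
Lemma jacobi_m1mod d n : (0 < d)%N -> (8 %| n.+1)%N -> (d %| n.+1)%N ->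
  jacobi d n = 1.
Proof.
move=> d0 n8 nd; have no : odd n by lia.
have [i [m [mo Ed]]] := odd_part d0.
have nm : (m %| n.+1)%N by apply: dvdn_trans nd; rewrite Ed dvdn_mull.
have mn : coprime m n by apply: coprime_dvdl nm _; exact: coprimeSn.
rewrite Ed PoszM jacobiMl // -[Posz (2 ^ i)]natz natrX jacobi_exp //.
rewrite jacobi2_1mod8; last by right; lia.
rewrite expr1n mul1r jacobi_flip //.
rewrite (@jacobi_modr n (-1)) //; last by rewrite opprK -PoszD addn1.
rewrite jacobiN1 // -exprD -signr_odd oddD oddM.
have -> : odd n./2 = true by lia.
by rewrite andbT addbb.
Qed.

(** * Primes with prescribed quadratic characters *)

(** Squares of the least prime factor are removed until that prime occurs only once; it then has odd
    exponent in [n]. *)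
Lemma square_or_odd_prime_power n : (0 < n)%N ->
  (exists s, n = s ^ 2)%N \/
  exists s q d, [/\ prime q, ~~ (q %| d)%N & n = (s ^ 2 * (q * d))%N].
Proof.
elim/ltn_ind: n => n IH n0; have [->|n1] := eqVneq n 1%N; first by left; exists 1%N.
have n2 : (1 < n)%N by lia.
have pp := pdiv_prime n2; set p := pdiv n in pp.
have [m Em] : exists m, n = (p * m)%N.
  by exists (n %/ p)%N; rewrite mulnC divnK ?pdiv_dvd.
have [/dvdnP[k Ek]|npm] := boolP (p %| m)%N; last first.
  by right; exists 1%N, p, m; rewrite mul1n.
have p1 := prime_gt1 pp; have k0 : (0 < k)%N by nia.
have kn : (k < n)%N by rewrite Em Ek; nia.
case: (IH k kn k0) => [[s Es]|[s [q [d [qp qd Es]]]]].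
  by left; exists (p * s)%N; rewrite Em Ek Es; ring.
by right; exists (p * s)%N, q, d; split=> //; rewrite Em Ek Es; ring.
Qed.

Lemma gt_of_coprime_fact p N n : prime p -> (p %| n)%N -> coprime n N`! -> (N < p)%N.
Proof.
move=> pp pn cn; rewrite ltnNge; apply/negP => pN.
have : (p %| N`!)%N by rewrite dvdn_fact // prime_gt0.
move/(fun h => coprime_dvdr h (coprime_dvdl pn cn)).
by rewrite /coprime gcdnn; have := prime_gt1 pp; lia.
Qed.

Lemma legendre_mod (p a b : nat) : prime p -> a = b %[mod p] ->
  legendre a p = legendre b p /\ legendre (- a%:Z) p = legendre (- b%:Z) p.
Proof.
move=> pp ab; rewrite /legendre !rmorphN /= -!pmulrn.
suff -> : (a%:R : 'F_p) = b%:R by [].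
rewrite (divn_eq a p) (divn_eq b p) ab !natrD !natrM.
by rewrite (pchar_Fp_0 pp) !mulr0 !add0r.
Qed.

Lemma nonresidue_prime_of_neg d N : (0 < d)%N ->
  exists p : nat, [/\ prime p, odd p, (N < p)%N & legendre (- d%:Z) p = -1].
Proof.
(* This [n] is -1 modulo 8, modulo [d] and modulo [N!]. So -1 has symbol -1 and [d] has symbol 1,
   while every prime factor of [n] exceeds [N]. *)
move=> d0; pose n := (8 * d * N`!).-1.
have n1 : n.+1 = (8 * d * N`!)%N by rewrite prednK // !muln_gt0 d0 fact_gt0.
have n8 : (8 %| n.+1)%N by rewrite n1 -mulnA dvdn_mulr.
have no : odd n by lia.
have J : jacobi (- d%:Z) n = -1.
  rewrite -[- d%:Z]mulN1r jacobiMl // jacobiN1 // jacobi_m1mod //; last first.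
    by rewrite n1 mulnAC dvdn_mull.
  by rewrite -signr_odd (_ : odd n./2) //; lia.
have [p [pp po pn pl]] := jacobi_eqN1 no J.
exists p; split=> //; apply: gt_of_coprime_fact pp pn _.
apply: coprime_dvdr (coprimenS n); rewrite n1; exact: dvdn_mull.
Qed.

(** With n = s^2 q d and [q] prime to [d], the Chinese remainder theorem gives a [k] modulo which
    [d] has symbol 1 and [q] has symbol -1. Keeping [k] prime to [s] and to [N!] makes the square
    harmless and the prime factors large. *)
Lemma nonresidue_prime_of_nonsquare n N : (0 < n)%N -> (forall s, n <> s ^ 2)%N ->
  exists p : nat, [/\ prime p, odd p, (N < p)%N & legendre n p = -1].
Proof.
move=> n0 nsq; case: (square_or_odd_prime_power n0) => [[s /nsq]//|].
case=> s [q [d [qp qd En]]].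
have s0 : (0 < s)%N by move: n0; rewrite En; case: (s).
have d0 : (0 < d)%N by move: n0; rewrite En; case: (d); rewrite ?muln0.
(* The part of [s * N!] prime to [q]: the congruence modulo [q] is imposed separately and must stay
   compatible. *)
pose T := ((s * N`!)`_q^')%N; have T0 : (0 < T)%N := part_gt0 _ _.
have qT : coprime q T.
  by apply: (@pnat_coprime q); [exact: pnat_id | exact: part_pnat].
suff [k [ko kT kq Jk]] : exists k, [/\ odd k, coprime k T, coprime k q
     & jacobi (q%:Z * d%:Z) k = -1].
  have ksN : coprime k (s * N`!).
    rewrite -(partnC q (n := s * N`!)) ?muln_gt0 ?s0 ?fact_gt0 //.
    by rewrite coprimeMr kT andbT p_part coprimeXr.
  move: ksN; rewrite coprimeMr => /andP[ks kN].
  have J : jacobi n k = -1.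
    rewrite En PoszM jacobiMl // -mulnn PoszM -expr2.
    by rewrite jacobi_sqr ?mul1r ?PoszM // coprime_sym.
  have [p [pp po pn pl]] := jacobi_eqN1 ko J.
  by exists p; split=> //; apply: gt_of_coprime_fact pp pn kN.
(* For [q = 2] the symbol -1 comes from [k = 5] modulo 8; for odd [q] it comes from [k] being a
   nonresidue modulo [q], flipped with [k = 1] modulo 8. *)
have [q2|qn2] := eqVneq q 2%N.
  subst q; have od : odd d by move: qd; rewrite dvdn2 negbK.
  have cop : coprime 8 (d * T).
    by rewrite -[8%N]/(2 ^ 3)%N coprime_pexpl // coprimeMr coprime2n od.
  have [k [k8 kdT]] : exists k, k = 5 %[mod 8] /\ k = 1 %[mod d * T].
    by exists (chinese 8 (d * T) 5 1); rewrite chinese_modl ?chinese_modr.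
  have ko : odd k by lia.
  have kd : k = 1 %[mod d].
    by move/(congr1 (modn^~ d)): kdT; rewrite !modn_dvdm ?dvdn_mulr.
  have kT : k = 1 %[mod T].
    by move/(congr1 (modn^~ T)): kdT; rewrite !modn_dvdm ?dvdn_mull.
  have coprime_of_mod1 m : k = 1 %[mod m] -> coprime k m.
    by move=> km; rewrite -coprime_modl km coprime_modl coprime1n.
  exists k; split=> //; [exact: coprime_of_mod1 | by rewrite coprimen2 |].
  rewrite jacobiMl // jacobi2_5mod8 // jacobi_flip_1mod4 //; last first.
  - by rewrite coprime_sym coprime_of_mod1.
  - by rewrite -(modn_dvdm k (isT : 4 %| 8)%N) k8.
  by rewrite jacobi_mod1 ?odd_gt0.
have qo : odd q by case: (even_prime qp) qn2 => // ->.
have [r rq] := exists_nonresidue qp qo.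
have cop : coprime (8 * d * T) q.
  rewrite !coprimeMl ![coprime _ q]coprime_sym qT [coprime q d]prime_coprime // qd.
  by rewrite -[8%N]/(2 ^ 3)%N coprime_pexpr // coprimen2 qo.
have [k [kM kq]] : exists k, k = 1 %[mod 8 * d * T] /\ k = r %[mod q].
  by exists (chinese (8 * d * T) q 1 r); rewrite chinese_modl ?chinese_modr.
have mod1 m : (m %| 8 * d * T)%N -> k = 1 %[mod m].
  by move=> mM; move/(congr1 (modn^~ m)): kM; rewrite !modn_dvdm.
have k8 : (k %% 8 = 1)%N by rewrite mod1 // -mulnA dvdn_mulr.
have ko : odd k by rewrite (divn_eq k 8) k8 oddD oddM andbF.
have legk : legendre k q = -1 by rewrite (legendre_mod qp kq).1.
have ckq : coprime k q.
  rewrite coprime_sym prime_coprime //; apply/negP => qk.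
  by move: legk; rewrite /legendre Fp_intr_eq0 // qk.
exists k; split=> //.
  by rewrite -coprime_modl mod1 ?coprime_modl ?coprime1n // dvdn_mull.
rewrite jacobiMl // (@jacobi_1mod d) // ?mulr1; last by rewrite mod1 // mulnAC dvdn_mull.
rewrite jacobi_flip_1mod4 //; last by rewrite coprime_sym.
  by rewrite (jacobi_prime _ qp).
by rewrite -(modn_dvdm k (isT : 4 %| 8)%N) k8.
Qed.

Lemma coprime_dvd_add (e : nat) (a b : int) :
  (e %| a + b)%Z -> coprime `|a| e -> coprime `|b| e.
Proof.
move=> eab ae; set g := gcdn `|b| e.
have ga : (g %| a)%Z.
  rewrite -(addrK b a) rpredB //; last exact: dvdn_gcdl.
  by apply: dvdn_trans eab; exact: dvdn_gcdr.
rewrite /coprime -/g -dvdn1 -(eqP ae) dvdn_gcd dvdn_gcdr andbT.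
exact: ga.
Qed.

(** Let [k] be the odd part of [m]. As -m is a square modulo [e], and modulo [e] the symbols of -1
    and 2 are -1 and 1, that of [k] is -1. Reciprocity equates it with the symbol of [- e] modulo
    [k], which is 1 by the hypothesis on the prime factors. *)
Lemma neg_square_mod_nonresidue e m (b : int) :
  (e %% 8 = 7)%N -> (0 < m)%N -> coprime m e -> (e %| m%:Z + b ^+ 2)%Z ->
  (forall p : nat, prime p -> odd p -> (p %| m)%N -> legendre (- e%:Z) p = 1) -> False.
Proof.
move=> e8 m0 me emb H; have eo : odd e by lia.
have [i [k [ko Em]]] := odd_part m0.
have ke : coprime k e by apply: coprime_dvdl me; rewrite Em dvdn_mull.
have Jek : jacobi (- e%:Z) k = 1.
  by apply: jacobi_eq1 => // p pp po pk; apply: H => //; rewrite Em dvdn_mull.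
have be : coprime `|b| e.
  rewrite -(coprime_pexpl _ _ (isT : (0 < 2)%N)) -abszX.
  exact: coprime_dvd_add emb me.
have : jacobi (- m%:Z) e = 1.
  rewrite (@jacobi_modr _ (b ^+ 2)) ?jacobi_sqr //.
  by rewrite -opprD abszN.
rewrite Em -[- _%:Z]mulN1r PoszM -[Posz (2 ^ i)]natz natrX !jacobiMl //.
rewrite jacobi_exp // jacobi2_1mod8; last by right.
rewrite expr1n mul1r jacobi_flip //.
move: Jek; rewrite -[- _%:Z]mulN1r jacobiMl // !jacobiN1 //.
have -> : (-1 : int) ^+ e./2 = -1 by rewrite -signr_odd (_ : odd e./2) //; lia.
rewrite -[(-1) ^+ (_ * _)]signr_odd oddM (_ : odd e./2 = true); last by lia.
by rewrite andbT signr_odd => ->.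
Qed.

Lemma crt_nonresidues M (ps : seq nat) K : (0 < M)%N -> uniq ps ->
  {in ps, forall p, [/\ prime p, odd p & coprime M p]} ->
  exists e, [/\ (K < e)%N, (M %| e.+1)%N & {in ps, forall p : nat, legendre (- e%:Z) p = -1}].
Proof.
move=> M0 ups psP.
suff [x [xM xps]] : exists x, (M %| x.+1)%N /\
    {in ps, forall p : nat, legendre (- x%:Z) p = -1}.
  (* Adding a multiple of [M] and of all the primes makes the solution exceed [K] without changing
     any residue. *)
  exists (x + M * \prod_(p <- ps) p * K.+1)%N; split.
  - have P0 : (0 < \prod_(p <- ps) p)%N.
      by rewrite big_seq prodn_cond_gt0 // => p /psP[pp _ _]; exact: prime_gt0.
    have : (0 < M * \prod_(p <- ps) p)%N by rewrite muln_gt0 M0.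
    nia.
  - by rewrite -addSn dvdn_addr // -mulnA dvdn_mulr.
  move=> p pin; rewrite -(xps _ pin); apply: (legendre_mod _ _).2.
    by case/psP: pin.
  rewrite (perm_big _ (perm_to_rem pin)) big_cons /=.
  set Q := (\prod_(_ <- _) _)%N.
  by rewrite (_ : M * (p * Q) * K.+1 = M * Q * K.+1 * p)%N ?[(x + _)%N]addnC ?modnMDl //; ring.
elim: ps ups psP => [_ _|p ps IH /= /andP[pps ups] psP].
  by exists M.-1; rewrite prednK.
have [|x [xM xps]] := IH ups; first by move=> q qin; apply: psP; rewrite inE qin orbT.
have [pp po Mp] := psP p (mem_head _ _).
have [r rp] := exists_nonresidue pp po.
have cop : coprime (M * \prod_(q <- ps) q) p.
  rewrite coprimeMl Mp coprime_sym big_seq.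
  apply: (big_rec (coprime p)) => [|q y qin cy]; first exact: coprimen1.
  have [qp _ _] := psP q (@mem_behead _ (p :: ps) _ qin).
  rewrite coprimeMr cy andbT prime_coprime // dvdn_prime2 //.
  by apply: contraNneq pps => ->.
(* Modulo [p], [r * p.-1] is [- r], so [- y] is the nonresidue [r]. *)
have [y [y1 y2]] : exists y, y = x %[mod M * \prod_(q <- ps) q] /\ y = r * p.-1 %[mod p].
  exists (chinese (M * \prod_(q <- ps) q) p x (r * p.-1)).
  by rewrite chinese_modl ?chinese_modr.
have mod_dvd q : (q %| M * \prod_(q <- ps) q)%N -> y = x %[mod q].
  by move=> qM; move/(congr1 (modn^~ q)): y1; rewrite !modn_dvdm.
exists y; split.
  by rewrite /dvdn -addn1 -modnDml mod_dvd ?dvdn_mulr // modnDml addn1.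
move=> q; rewrite inE => /predU1P[->|qin].
  rewrite (legendre_mod pp y2).2 -rp /legendre.
  suff -> : ((- (r * p.-1)%N%:Z)%:~R : 'F_p) = (r%:Z)%:~R by [].
  rewrite rmorphN /= -!pmulrn natrM -subn1 natrB ?prime_gt0 // pchar_Fp_0 //.
  by rewrite sub0r mulrN1 opprK.
rewrite -(xps _ qin); apply: (legendre_mod _ _).2.
  by have [] := psP q (@mem_behead _ (p :: ps) _ qin).
by apply: mod_dvd; rewrite (perm_big _ (perm_to_rem qin)) big_cons /= mulnCA dvdn_mulr.
Qed.

(** * Quaternary forms of nonsquare determinant *)

Lemma row_free_complete (F : fieldType) m n (W : 'M[F]_(m, m + n)) :
  row_free W -> exists V : 'M_(n, m + n), col_mx W V \in unitmx.
Proof.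
move=> Wfree; exists (dsubmx (row_ebase W)).
have -> : col_mx W (dsubmx (row_ebase W)) =
    block_mx (col_ebase W) 0 0 1%:M *m row_ebase W.
  rewrite -[X in _ = _ *m X]vsubmxK mul_block_col !mul0mx mul1mx add0r addr0.
  congr col_mx; rewrite -[LHS]mulmx_ebase (eqP Wfree) pid_mx_row.
  by rewrite -[X in _ *m X = _]vsubmxK -mulmxA mul_row_col mul1mx mul0mx addr0.
by rewrite unitmx_mul row_ebase_unit unitmxE det_lblock det1 mulr1 -unitmxE col_ebase_unit.
Qed.

(** Multiplying by this matrix exchanges the two block columns up to sign, which makes a Gram matrix
    with a zero corner block triangular. *)
Lemma det_block_antidiag1 (R : comNzRingType) n :
  \det (block_mx 0 (- 1%:M) 1%:M 0 : 'M[R]_(n + n)) = 1.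
Proof.
have -> : block_mx 0 (- 1%:M) 1%:M 0 = block_mx 1%:M (- 1%:M) 0 1%:M *m
   block_mx 1%:M 0 1%:M 1%:M *m block_mx 1%:M (- 1%:M) 0 1%:M :> 'M[R]_(n + n).
  by rewrite !mulmx_block
    !(mul0mx, mulmx0, mul1mx, mulmx1, addr0, add0r, subrr, addNr, mulNmx).
by rewrite !det_mulmx !det_ublock det_lblock !det1 !mulr1.
Qed.

(** In a basis extending [W] the Gram matrix has a zero upper left block, so its determinant is that
    of the off-diagonal block squared, up to the sign; the change of basis contributes another
    square. *)
Lemma isotropic_half_det (F : fieldType) n (G : 'M[F]_(n + n)) (W : 'M_(n, n + n)) :
  G^T = G -> row_free W -> W *m G *m W^T = 0 ->
  exists t, \det G = (-1) ^+ n * t ^+ 2.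
Proof.
move=> GT Wfree W0; have [V Nunit] := row_free_complete Wfree.
set N := col_mx W V in Nunit; pose Y := W *m G *m V^T.
have EN : N *m G *m N^T = block_mx 0 Y Y^T (V *m G *m V^T).
  rewrite mul_col_mx tr_col_mx mul_col_row W0; congr block_mx.
  by rewrite /Y !trmx_mul trmxK GT mulmxA.
have detE : \det (N *m G *m N^T) = (-1) ^+ n * \det Y ^+ 2.
  rewrite EN -[LHS]mulr1 -[X in _ * X](det_block_antidiag1 F n) -det_mulmx mulmx_block.
  rewrite !(mul0mx, mulmx0, mulmx1, addr0, add0r) mulmxN mulmx1 det_lblock.
  by rewrite -scaleN1r detZ det_tr mulrCA expr2.
have dN : \det N != 0 by rewrite -unitfE -unitmxE.
exists (\det Y / \det N); move: detE; rewrite !det_mulmx det_tr => detE.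
rewrite expr_div_n mulrA -detE; by field.
Qed.

Lemma det_mx4 (R : comNzRingType) (h : nat -> nat -> R) :
  \det (\matrix_(i < 4, j < 4) h i j) =
  h 0 0 * (h 1 1 * (h 2 2 * h 3 3 - h 2 3 * h 3 2) - h 1 2 * (h 2 1 * h 3 3 - h 2 3 * h 3 1)
           + h 1 3 * (h 2 1 * h 3 2 - h 2 2 * h 3 1))
  - h 0 1 * (h 1 0 * (h 2 2 * h 3 3 - h 2 3 * h 3 2) - h 1 2 * (h 2 0 * h 3 3 - h 2 3 * h 3 0)
           + h 1 3 * (h 2 0 * h 3 2 - h 2 2 * h 3 0))
  + h 0 2 * (h 1 0 * (h 2 1 * h 3 3 - h 2 3 * h 3 1) - h 1 1 * (h 2 0 * h 3 3 - h 2 3 * h 3 0)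
           + h 1 3 * (h 2 0 * h 3 1 - h 2 1 * h 3 0))
  - h 0 3 * (h 1 0 * (h 2 1 * h 3 2 - h 2 2 * h 3 1) - h 1 1 * (h 2 0 * h 3 2 - h 2 2 * h 3 0)
           + h 1 2 * (h 2 0 * h 3 1 - h 2 1 * h 3 0)).
Proof.
(* Entries indexed by [nat] let the minors of [M] be again of the form [M], with indices shifted by
   [bump]. *)
pose M n (f : nat -> nat -> R) : 'M_n := \matrix_(i, j) f i j.
have ME n f i j : M n f i j = f i j by rewrite mxE.
have det1' f : \det (M 1 f) = f 0 0 by rewrite det_mx11 ME.
have minor n f (j : 'I_n.+1) : cofactor (M n.+1 f) 0 j =
    (-1) ^+ j * \det (M n (fun i k => f i.+1 (bump j k))).
  rewrite /cofactor add0n; congr (_ * \det _).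
  by apply/matrixP => i k; rewrite !mxE.
have det2 f : \det (M 2 f) = f 0 0 * f 1 1 - f 0 1 * f 1 0.
  rewrite (expand_det_row _ 0) !big_ord_recl big_ord0 !minor !ME /= !det1' /bump /=.
  by ring.
have det3 f : \det (M 3 f) =
  f 0 0 * (f 1 1 * f 2 2 - f 1 2 * f 2 1) - f 0 1 * (f 1 0 * f 2 2 - f 1 2 * f 2 0)
  + f 0 2 * (f 1 0 * f 2 1 - f 1 1 * f 2 0).
  rewrite (expand_det_row _ 0) !big_ord_recl big_ord0 !minor !ME /= !det2 /bump /=.
  by ring.
rewrite -[\matrix_(i, j) _]/(M 4 h).
rewrite (expand_det_row _ 0) !big_ord_recl big_ord0 !minor !ME /= !det3 /bump /=.
by ring.
Qed.

Lemma legendre_nonsquare p (a : int) (t : 'F_p) : prime p -> odd p ->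
  legendre a p = -1 -> t ^+ 2 != a%:~R.
Proof.
move=> pp po la; apply/eqP => ta; have [t0|t0] := eqVneq t 0; last first.
  by have := legendre_sqr pp po ta t0; rewrite la.
by move: la; rewrite /legendre -ta t0 expr0n eqxx.
Qed.

Section Reduction.
Variables (p : nat) (p_prime : prime p) (n : nat).
Implicit Types (x y : 'rV[int]_n) (G : 'M[int]_n).

Local Notation red := (map_mx (intr : int -> 'F_p)).

Lemma bform_red G x y : bform (red G) (red x) (red y) = (bform G x y)%:~R.
Proof. by rewrite /bform map_trmx -!map_mxM mxE. Qed.

Lemma red_eq0 x : red x = 0 -> exists w, x = p%:Z *: w.
Proof.
move=> /rowP x0; exists (\row_i divz (x 0 i) p); apply/rowP=> i; rewrite !mxE.
by move: (x0 i); rewrite !mxE => /eqP; rewrite Fp_intr_eq0 // => pxi; rewrite mulrC divzK.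
Qed.

Lemma red_surj (u : 'rV['F_p]_n) : exists x, red x = u.
Proof.
exists (\row_i (u 0 i : nat)%:Z); apply/rowP=> i; rewrite !mxE.
by rewrite -pmulrn natr_Zp.
Qed.

End Reduction.

Lemma Fp_lift p (a : 'F_p) : exists A : int, A%:~R = a.
Proof. by exists (a : nat)%:Z; rewrite -pmulrn natr_Zp. Qed.

Lemma row_free_or_relation (F : fieldType) m n (W : 'M[F]_(m, n)) :
  row_free W \/ exists2 c : 'rV_m, c != 0 & c *m W = 0.
Proof.
have [|nfree] := boolP (row_free W); [by left | right].
exists (nz_row (kermx W)); first by rewrite nz_row_eq0 kermx_eq0.
by apply/eqP; rewrite -sub_kermx nz_row_sub.
Qed.

Lemma neg_square_of_norm_eq0 (F : fieldType) (a b e : F) :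
  a ^+ 2 + e * b ^+ 2 = 0 -> (a, b) != (0, 0) -> (a / b) ^+ 2 = - e /\ b != 0.
Proof.
move=> ab0 nz; have b0 : b != 0.
  apply: contraNneq nz => b0; move: ab0; rewrite b0 expr0n mulr0 addr0 => /eqP.
  by rewrite sqrf_eq0 => /eqP ->.
split=> //; move/eqP: ab0; rewrite addr_eq0 expr_div_n => /eqP ->.
by field.
Qed.

(** Modulo [p] the span of [x] and [y] is totally isotropic. If it is a plane, [\det G] is a square
    modulo [p]; if not, a nontrivial relation makes [- e] a square modulo [p]. *)
Lemma nonsquare_det_obstruction (G : 'M[int]_4) p (u e : int) x y :
  G^T = G -> prime p -> odd p -> legendre (\det G) p = -1 -> legendre (- e) p = -1 ->
  ~~ (p %| u)%Z -> bform G x x = p%:Z * u -> bform G y y = p%:Z * u * e ->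
  bform G x y = 0 -> False.
Proof.
move=> GT pp po lG le pu xx yy xy.
have redGT : (map_mx (intr : int -> 'F_p) G)^T = map_mx intr G by rewrite map_trmx GT.
have yx : bform G y x = 0 by rewrite bformC.
have p0 : (p%:Z%:~R : 'F_p) = 0 by rewrite -pmulrn pchar_Fp_0.
pose X : 'M['F_p]_(2, 4) := \matrix_i map_mx intr (nth 0 [:: x; y] i).
have rowX i : row i X = map_mx intr (nth 0 [:: x; y] i) by rewrite rowK.
have [Xfree|[c c0 cX]] := row_free_or_relation X.
  have [|t] := @isotropic_half_det 'F_p 2 (map_mx intr G) X redGT Xfree; last first.
    rewrite sqrrN expr1n mul1r det_map_mx => /esym/eqP.
    by rewrite (negPf (legendre_nonsquare _ pp po lG)).
  apply/matrixP => i j; rewrite bform_mul [RHS]mxE !rowX bform_red.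
  by case: i j => [[|[]]] // ? [[|[]]] // ?; rewrite ?xx ?yy ?xy ?yx ?intrM ?p0 ?mul0r.
have [A Aa] := Fp_lift (c 0 0); have [B Bb] := Fp_lift (c 0 1).
have ab0 : (c 0 0, c 0 1) != (0, 0).
  apply: contraNneq c0 => -[a0 b0]; apply/eqP/rowP => i; rewrite mxE.
  by case: i => [[|[]]] // ilt; [rewrite -[RHS]a0|rewrite -[RHS]b0];
    congr (c _ _); apply: val_inj.
(* The relation puts [A x + B y] in [p] times the lattice. Its norm [p * u * (A ^+ 2 + e * B ^+ 2)]
   is then divisible by p^2, and [p] does not divide [u]. *)
have [|w Ew] := @red_eq0 p pp _ (A *: x + B *: y).
  rewrite map_mxD !map_mxZ /= Aa Bb -[RHS]cX mulmx_sum_row !big_ord_recl big_ord0 addr0.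
  by rewrite !rowX /=; congr (_ + c _ _ *: _); apply: val_inj.
have : bform G (A *: x + B *: y) (A *: x + B *: y) = p%:Z * (p%:Z * bform G w w).
  by rewrite Ew bformZl bformZr.
rewrite !(bformDl, bformDr, bformZl, bformZr) xx yy xy yx.
have -> : A * (A * (p%:Z * u)) + A * (B * 0) + (B * (A * 0) + B * (B * (p%:Z * u * e)))
  = p%:Z * (u * (A ^+ 2 + e * B ^+ 2)) by ring.
have pz : p%:Z != 0 by rewrite eqz_nat -lt0n prime_gt0.
move/(mulfI pz)/(congr1 (intr : int -> 'F_p)).
rewrite !(rmorphM, rmorphD, rmorphXn) /= p0 mul0r Aa Bb => /eqP.
have /negPf pu' : ~~ (p %| `|u|)%N := pu.
rewrite mulf_eq0 Fp_intr_eq0 // pu' /= => /eqP /neg_square_of_norm_eq0 /(_ ab0) [sq _].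
have := legendre_nonsquare (c 0 0 / c 0 1) pp po le.
by rewrite sq rmorphN eqxx.
Qed.

(** * Quaternary forms of square determinant *)

(** The vector [z] collects Bezout coefficients: its product with [v] is a gcd of the entries, built
    one entry at a time. *)
Lemma row_bezout n (v : 'rV[int]_n) :
  exists z : 'rV[int]_n, forall i, ((v *m z^T)%R 0%R 0%R %| v 0%R i)%Z.
Proof.
suff H (s : seq 'I_n) : exists z : 'rV[int]_n,
    {in s, forall i, ((v *m z^T)%R 0%R 0%R %| v 0%R i)%Z}.
  by have [z Hz] := H (enum 'I_n); exists z => i; apply: Hz; rewrite mem_enum.
elim: s => [|j s [z Hz]]; first by exists 0.
have [a [b Eab]] : exists a b, a * (v *m z^T) 0 0 + b * v 0 j = gcdz ((v *m z^T) 0 0) (v 0 j).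
  by case: (Bezoutz ((v *m z^T) 0 0) (v 0 j)) => a [b E]; exists a, b.
exists (a *: z + b *: delta_mx 0 j).
have -> : (v *m (a *: z + b *: delta_mx 0 j)^T) 0 0 = gcdz ((v *m z^T) 0 0) (v 0 j).
  by rewrite -Eab linearD !linearZ /= mulmxDr -!scalemxAr trmx_delta -colE !mxE.
move=> i; rewrite inE => /predU1P[->|iin]; first exact: dvdz_gcdr.
by apply: dvdz_trans (Hz i iin); exact: dvdz_gcdl.
Qed.

(* When [x] and [y] are orthogonal of norms [P] and [P * e], this is the form
   induced on the orthogonal complement of [x] and [y], scaled by [P * e]. *)
Definition proj_form n (G : 'M[int]_n) (P e : int) (x y z w : 'rV[int]_n) : int :=
  P * e * bform G z w - e * (bform G x z * bform G x w) - bform G y z * bform G y w.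

(** This is the Schur complement formula: the Gram determinant of [x], [y], [z], [w] is P^2 e times
    that of the projections of [z] and [w], and [proj_form] scales the latter by (P e)^2. *)
Lemma proj_form_det (G : 'M[int]_4) (P e : int) x y z w :
  G^T = G -> bform G x x = P -> bform G y y = P * e -> bform G x y = 0 ->
  proj_form G P e x y z z * proj_form G P e x y w w - proj_form G P e x y z w ^+ 2 =
  e * \det G * \det (\matrix_(i < 4) nth 0 [:: x; y; z; w] i) ^+ 2.
Proof.
move=> GT xx yy xy; set N := \matrix_i _.
pose h i j := bform G (nth 0 [:: x; y; z; w] i) (nth 0 [:: x; y; z; w] j).
have -> : e * \det G * \det N ^+ 2 = e * \det (\matrix_(i < 4, j < 4) h i j).
  have -> : \matrix_(i < 4, j < 4) h i j = N *m G *m N^T.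
    by apply/matrixP => i j; rewrite bform_mul !rowK mxE.
  by rewrite !det_mulmx det_tr; ring.
rewrite det_mx4 /h /= /proj_form xx yy xy.
rewrite (bformC z x GT) (bformC w x GT) (bformC y x GT) (bformC z y GT).
rewrite (bformC w y GT) (bformC w z GT) xy.
by ring.
Qed.

Lemma proj_form_radical n (G : 'M[int]_n) (P e : int) x y w a b c :
  G^T = G -> bform G x x = P -> bform G y y = P * e -> bform G x y = 0 ->
  proj_form G P e x y (a *: x + b *: y + c *: w) (a *: x + b *: y + c *: w) =
  c ^+ 2 * proj_form G P e x y w w.
Proof.
move=> GT xx yy xy; rewrite /proj_form !(bformDl, bformDr, bformZl, bformZr).
rewrite (bformC w x GT) (bformC w y GT) (bformC y x GT) xx yy xy.
by ring.
Qed.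

Lemma proj_form_ge0 n (G : 'M[int]_n) (P e : int) x y z :
  pos_def G -> 0 < P * e -> bform G x x = P -> bform G y y = P * e -> bform G x y = 0 ->
  0 <= proj_form G P e x y z z.
Proof.
case=> GT Gpos Pe xx yy xy.
(* [P * e] times the orthogonal projection of [z], cleared of denominators. *)
pose w := (P * e) *: z - (e * bform G x z) *: x - bform G y z *: y.
have Ew : bform G w w = P * e * proj_form G P e x y z z.
  rewrite /w /proj_form !(bformDl, bformDr, bformNl, bformNr, bformZl, bformZr).
  rewrite (bformC z x GT) (bformC z y GT) (bformC y x GT) xx yy xy.
  by ring.
rewrite -(pmulr_rge0 _ Pe) -Ew.
have [->|w0] := eqVneq w 0; last exact: ltW (Gpos _ w0).
by rewrite /bform mul0mx mul0mx mxE.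
Qed.

Lemma prime_sqr_dvdM p P (k : int) : prime p -> ~~ (p ^ 2 %| P)%N ->
  (p%:Z ^+ 2 %| P%:Z * k)%Z -> (p %| k)%Z.
Proof.
move=> pp pP; rewrite !dvdzE abszM abszX /= => pPk.
apply: contraR pP => npk.
by rewrite -(@Gauss_dvdl _ _ `|k|%N) // coprimeXl // prime_coprime.
Qed.

(** Modulo [p] the identity reads -q^2 = e s^2 j^2, so [- e] is the square of q / (s j). *)
Lemma legendre_of_discriminant p (a b q s j : int) (e : nat) :
  prime p -> odd p -> a * b - q ^+ 2 = e%:Z * s ^+ 2 * j ^+ 2 ->
  (p %| a)%Z -> ~~ (p %| e)%N -> ~~ (p %| s)%Z -> (j%:~R : 'F_p) != 0 ->
  legendre (- e%:Z) p = 1.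
Proof.
move=> pp po + pa pe ps j0; move/(congr1 (intr : int -> 'F_p)).
rewrite !expr2 rmorphB !rmorphM /= -!expr2.
have -> : (a%:~R : 'F_p) = 0 by apply/eqP; rewrite Fp_intr_eq0.
have s0 : (s%:~R : 'F_p) != 0 by rewrite Fp_intr_eq0.
have e0 : (e%:Z%:~R : 'F_p) != 0 by rewrite Fp_intr_eq0.
rewrite mul0r sub0r => E.
have E2 : (q%:~R / (s%:~R * j%:~R)) ^+ 2 = (- e%:Z)%:~R :> 'F_p.
  rewrite rmorphN /= expr_div_n exprMn; apply: (canLR (mulfK _)).
    by rewrite mulf_neq0 ?expf_neq0.
  by rewrite mulNr mulrA -E opprK.
by apply: (legendre_sqr pp po E2); rewrite -sqrf_eq0 E2 rmorphN oppr_eq0.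
Qed.

Lemma solve_linear_relation (F : fieldType) (V : lmodType F) (a b c : F) (u v w : V) :
  c != 0 -> a *: u + (b *: v + c *: w) = 0 -> w - (- (a / c) *: u + - (b / c) *: v) = 0.
Proof.
move=> c0 E; apply: (scalerI c0); rewrite scaler0 -[RHS]E scalerBr scalerDr !scalerA.
have cdiv t : c * - (t / c) = - t by field.
by rewrite !cdiv !scaleNr opprD !opprK addrC addrA.
Qed.

Section SquareDeterminant.
Variables (G : 'M[int]_4) (s : int) (P : nat).
Hypotheses (Gpos : pos_def G) (detG : \det G = s ^+ 2) (P0 : (0 < P)%N).
Hypothesis P_sqfree : forall p, prime p -> ~~ (p ^ 2 %| P)%N.

Let GT : G^T = G. Proof. by case: Gpos. Qed.

Section Primitive.
Variables (e : nat) (x y : 'rV[int]_4).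
Hypotheses (e8 : (e %% 8 = 7)%N)
  (se : forall p, prime p -> (p %| s)%Z ->
          ~~ (p %| e)%N /\ (odd p -> legendre (- e%:Z) p = 1))
  (xx : bform G x x = P) (yy : bform G y y = P%:Z * e%:Z) (xy : bform G x y = 0).

Let m z := proj_form G P e x y z z.

(** Modulo [e], [m z] is minus the square of [bform G y z]. *)
Let coprime_m z : coprime `|bform G y z| e -> coprime `|m z| e.
Proof.
move=> yz; apply: (@coprime_dvd_add _ (bform G y z ^+ 2)); last by rewrite abszX coprimeXl.
rewrite /m /proj_form.
have -> : bform G y z ^+ 2 + (P%:Z * e%:Z * bform G z z - e%:Z * (bform G x z * bform G x z)
   - bform G y z * bform G y z)
   = e%:Z * (P%:Z * bform G z z - bform G x z * bform G x z) by ring.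
exact: dvdz_mulr.
Qed.

(* Minimality of [z] excludes [z = A x + B y + p w], for which [m w = m z / p^2]. *)
Let legendre_of_dvd_m (z : 'rV[int]_4) p :
  (forall w : 'rV[int]_4, coprime `|bform G y w| e -> (`|m z| <= `|m w|)%N) ->
  coprime `|bform G y z| e -> (0 < `|m z|)%N ->
  prime p -> odd p -> (p %| m z)%Z -> legendre (- e%:Z) p = 1.
Proof.
move=> zmin yze mz0 pp po pm.
have [ps|nps] := boolP (p %| s)%Z; first by case: (se pp ps) => _; apply.
have npe : ~~ (p %| e)%N.
  rewrite -prime_coprime //; apply: coprime_dvdl (coprime_m yze); exact: pm.
have p0 : (p%:Z%:~R : 'F_p) = 0 by rewrite -pmulrn pchar_Fp_0.
have yx : bform G y x = 0 by rewrite bformC.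
pose X : 'M['F_p]_(3, 3 + 1) := \matrix_i map_mx intr (nth 0 [:: x; y; z] i).
have rowX i : row i X = map_mx intr (nth 0 [:: x; y; z] i) by rewrite rowK.
have [Xfree|[c c0 cX]] := row_free_or_relation X.
  (* When [x], [y], [z] are independent modulo [p], a fourth vector [w] makes the transition
     determinant a unit, and the discriminant identity applies since [p] divides [m z]. *)
  have [V XVunit] := row_free_complete Xfree.
  have [w Ew] := red_surj V.
  have := proj_form_det z w GT xx yy xy; rewrite -/(m z) detG.
  set N := \matrix_i _.
  have dN : ((\det N)%:~R : 'F_p) != 0.
    rewrite -det_map_mx -unitfE -unitmxE.
    suff -> : map_mx intr N = col_mx X V by [].
    apply/row_matrixP => i; rewrite -map_row rowK.
    case: (@split_ordP 3 1 i) => k ->.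
      transitivity (row k X); last by symmetry; exact: rowKu.
      by rewrite rowX; case: k => [[|[|[]]]].
    transitivity (row k V); last by symmetry; exact: rowKd.
    by rewrite ord1 /= Ew row_id.
  by move=> E; apply: legendre_of_discriminant pp po E pm npe nps dN.
have relation : c 0 0 *: map_mx intr x + (c 0 1 *: map_mx intr y +
    c 0 ord_max *: map_mx intr z) = 0.
  rewrite -[RHS]cX mulmx_sum_row !big_ord_recl big_ord0 addr0 !rowX /=.
  have -> : lift ord0 (lift ord0 ord0) = ord_max :> 'I_3 by exact: val_inj.
  by have -> : lift ord0 ord0 = 1 :> 'I_3 by exact: val_inj.
(* A relation between [x] and [y] alone makes p^2 divide [P * (A ^+ 2 + e * B ^+ 2)]. As [P] is
   squarefree, [p] divides the second factor, and [- e] is a square modulo [p]. *)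
have [c2|c2] := eqVneq (c 0 ord_max) 0.
  have ab0 : (c 0 0, c 0 1) != (0, 0).
    apply: contraNneq c0 => -[a0 b0]; apply/eqP/rowP => i; rewrite mxE.
    by case: i => [[|[|[]]]] // ilt;
      [rewrite -[RHS]a0|rewrite -[RHS]b0|rewrite -[RHS]c2]; congr (c _ _); apply: val_inj.
  have [A Aa] := Fp_lift (c 0 0); have [B Bb] := Fp_lift (c 0 1).
  have [|w Ew] := @red_eq0 p pp _ (A *: x + B *: y).
    by rewrite map_mxD !map_mxZ /= Aa Bb -[RHS]relation c2 scale0r addr0.
  have : bform G (A *: x + B *: y) (A *: x + B *: y) = p%:Z ^+ 2 * bform G w w.
    by rewrite Ew bformZl bformZr; ring.
  rewrite !(bformDl, bformDr, bformZl, bformZr) xx yy xy yx.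
  have -> : A * (A * P%:Z) + A * (B * 0) + (B * (A * 0) + B * (B * (P%:Z * e%:Z)))
    = P%:Z * (A ^+ 2 + e%:Z * B ^+ 2) by ring.
  move=> E; have := @prime_sqr_dvdM p P (A ^+ 2 + e%:Z * B ^+ 2) pp (P_sqfree pp).
  rewrite E dvdz_mulr // => /(_ isT) pab.
  have : ((A ^+ 2 + e%:Z * B ^+ 2)%:~R : 'F_p) == 0 by rewrite Fp_intr_eq0.
  rewrite !(rmorphM, rmorphD, rmorphXn) /= Aa Bb => /eqP.
  case/neg_square_of_norm_eq0/(_ ab0) => sq b0.
  apply: (legendre_sqr pp po (x := c 0 0 / c 0 1)); first by rewrite sq rmorphN.
  by rewrite -sqrf_eq0 sq oppr_eq0 Fp_intr_eq0.
have [A Aa] := Fp_lift (- (c 0 0 / c 0 ord_max)).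
have [B Bb] := Fp_lift (- (c 0 1 / c 0 ord_max)).
have [|w Ew] := @red_eq0 p pp _ (z - (A *: x + B *: y)).
  rewrite map_mxB map_mxD !map_mxZ /= Aa Bb.
  exact: solve_linear_relation relation.
have {}Ew : z = A *: x + B *: y + p%:Z *: w by rewrite -Ew; rewrite addrC subrK.
have mE : m z = p%:Z ^+ 2 * m w by rewrite /m Ew proj_form_radical.
(* Since [y] is orthogonal to [x] and has norm divisible by [e], [bform G y z] is [p * bform G y w]
   modulo [e]; so [w] is an admissible competitor of [z]. *)
have yw : coprime `|bform G y w| e.
  have: coprime `|p%:Z * bform G y w| e.
    apply: (@coprime_dvd_add _ (- bform G y z)); last by rewrite abszN.
    rewrite Ew !(bformDr, bformZr) yx yy.
    have -> : - (A * 0 + B * (P%:Z * e%:Z) + p%:Z * bform G y w) + p%:Z * bform G y w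
      = - (B * P%:Z) * e%:Z by ring.
    exact: dvdz_mull.
  by rewrite abszM coprimeMl => /andP[].
have := zmin w yw; rewrite mE abszM abszX /=; move: mz0; rewrite mE abszM abszX /=.
rewrite muln_gt0 => /andP[_ k0].
by rewrite leqNgt ltn_Pmull // (ltn_trans (prime_gt1 pp)) // -{1}[p]expn1 ltn_exp2l ?prime_gt1.
Qed.

(** Primitivity of [y] yields some [z] with [bform G y z] prime to [e]. For such a [z] with [m z]
    minimal, [- m z] is a unit square modulo [e], while [- e] is a square modulo every odd prime
    factor of [m z]. *)
Lemma primitive_obstruction :
  (forall p w, prime p -> y != p%:Z *: w) -> False.
Proof.
move=> yprim.
have [z Hz] := row_bezout (y *m G).
have yz : coprime `|bform G y z| e.
  apply/negPn/negP; rewrite /coprime; set g := gcdn _ _ => g1.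
  have g0 : (0 < g)%N by rewrite gcdn_gt0 orbC; lia.
  have pp : prime (pdiv g) by apply: pdiv_prime; lia.
  have pe : (pdiv g %| e)%N := dvdn_trans (pdiv_dvd g) (dvdn_gcdr _ _).
  have pyz : (pdiv g %| bform G y z)%Z := dvdn_trans (pdiv_dvd g) (dvdn_gcdl _ _).
  set p := pdiv g in pp pe pyz.
  (* A prime factor of [e] does not divide [s], so [G] is invertible modulo [p]; then [y *m G = 0]
     modulo [p] would make [y] divisible by [p]. *)
  have nps : ~~ (p %| s)%Z by apply/negP => /(se pp)[]; rewrite pe.
  have redG : map_mx (intr : int -> 'F_p) G \in unitmx.
    rewrite unitmxE unitfE det_map_mx detG Fp_intr_eq0 // abszX Euclid_dvdX // andbT.
    exact: nps.
  have [|w yw] := @red_eq0 p pp _ y; last by have := yprim p w pp; rewrite yw eqxx.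
  rewrite -[LHS](mulmxK redG) -map_mxM.
  suff -> : map_mx (intr : int -> 'F_p) (y *m G) = 0 by rewrite mul0mx.
  apply/rowP => i; rewrite [LHS]mxE [RHS]mxE; apply/eqP; rewrite Fp_intr_eq0 //.
  exact: dvdz_trans pyz (Hz i).
have [k Ek] : exists k, k = `|m z|%N by exists `|m z|%N.
(* Strong induction on [m z] serves to assume [z] minimal. *)
elim/ltn_ind: k => k IH in z yz Ek {Hz}.
have zmin w : coprime `|bform G y w| e -> (`|m z| <= `|m w|)%N.
  by rewrite -Ek leqNgt => yw; apply/negP => wk; exact: IH wk w yw erefl.
have mz := coprime_m yz.
have mz0 : (0 < `|m z|)%N.
  by rewrite lt0n; apply: contraTneq mz => ->; rewrite /coprime gcd0n; lia.
apply: (@neg_square_mod_nonresidue e `|m z|%N (bform G y z)) => //.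
  have Pe : 0 < P%:Z * e%:Z by rewrite -PoszM; case: (e) e8 P0 => //; case: (P).
  rewrite gez0_abs; last exact: proj_form_ge0.
  have -> : m z + bform G y z ^+ 2 = e%:Z * (P%:Z * bform G z z - bform G x z * bform G x z).
    by rewrite /m /proj_form; ring.
  exact: dvdz_mulr.
by move=> p pp po pm; exact: legendre_of_dvd_m zmin yz mz0 pp po pm.
Qed.

End Primitive.

(** Descent on [e] reduces to primitive [y]. If [y = p w], then p^2 divides [P * e]; [P] is
    squarefree and prime to common factors with [e], so p^2 divides [e]. Replacing [e] by e / p^2
    keeps it 7 modulo 8, because [p] is odd. *)
Lemma square_det_obstruction e x y :
  (e %% 8 = 7)%N ->
  (forall p, prime p -> (p %| P)%N -> ~~ (p %| e)%N) ->
  (forall p, prime p -> (p %| s)%Z ->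
     ~~ (p %| e)%N /\ (odd p -> legendre (- e%:Z) p = 1)) ->
  bform G x x = P -> bform G y y = P%:Z * e%:Z -> bform G x y = 0 -> False.
Proof.
elim/ltn_ind: e y => e IH y e8 Pe se xx yy xy.
apply: (@primitive_obstruction e x y) => // p w pp; apply/eqP => yw.
have pPe : (p%:Z ^+ 2 %| P%:Z * e%:Z)%Z.
  by rewrite -yy yw bformZl bformZr mulrA -expr2 dvdz_mulr.
have pe : (p %| e)%N := prime_sqr_dvdM pp (P_sqfree pp) pPe.
have npP : ~~ (p %| P)%N by apply/negP => /(Pe p pp); rewrite pe.
have p2e : (p ^ 2 %| e)%N.
  move: pPe; rewrite dvdzE abszM abszX /= Gauss_dvdr //.
  by rewrite coprimeXl // prime_coprime.
have [e' Ee] := dvdnP p2e.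
have po : odd p.
  case: (even_prime pp) => // p2.
  by move: pe; rewrite p2 dvdn2 (divn_eq e 8) e8 oddD oddM andbF.
have p0 := prime_gt0 pp; have p1 := prime_gt1 pp.
have e0 : (0 < e')%N by case: (e') Ee e8 => [->|].
have p8 : (p ^ 2 %% 8 = 1)%N.
  rewrite -modnXm; have := ltn_pmod p (isT : (0 < 8)%N).
  have : odd (p %% 8) by rewrite (odd_mod p (erefl : odd 8 = false)).
  by move: (p %% 8)%N => [|[|[|[|[|[|[|[|]]]]]]]].
have EeZ : e%:Z = e'%:Z * p%:Z ^+ 2 by rewrite Ee PoszM -mulnn PoszM expr2.
have e'e : (e' < e)%N by rewrite Ee -{1}[e']muln1 ltn_pmul2l // -(exp1n 2) ltn_exp2r.
have divE q : (q %| e')%N -> (q %| e)%N by move=> qe; rewrite Ee dvdn_mulr.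
apply: (IH e' e'e w) => //.
- by move: e8; rewrite Ee -modnMmr p8 muln1.
- by move=> q qp qP; apply: contra (Pe q qp qP); exact: divE.
- move=> q qp qs; have [qe le] := se q qp qs; split; first by apply: contra qe; exact: divE.
  move=> qo; rewrite -(le qo) EeZ -mulNr legendreM //.
  have -> : legendre (p%:Z ^+ 2) q = 1; last by rewrite mulr1.
  apply: (@legendre_sqr q qp qo p%:Z%:~R); first by rewrite rmorphXn.
  rewrite Fp_intr_eq0 //; apply: contra qe => qp'.
  by rewrite Ee dvdn_mull // dvdn_exp.
- apply: (mulfI (_ : p%:Z ^+ 2 != 0)); first by rewrite expf_neq0 // eqz_nat -lt0n.
  have : bform G y y = p%:Z ^+ 2 * bform G w w by rewrite yw bformZl bformZr mulrA.
  by rewrite yy EeZ => <-; ring.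
move: xy; rewrite yw bformZr => /eqP; rewrite mulf_eq0 eqz_nat.
by rewrite (negPf (lt0n_neq0 p0)) => /eqP.
Qed.

End SquareDeterminant.

(** * The obstructing pairs *)

Lemma det_bound n (H : 'M[int]_n) (c : int) :
  (forall i j, `|H i j| <= c) -> `|\det H| <= n`!%:R * c ^+ n.
Proof.
move=> Hc; apply: le_trans (ler_norm_sum _ _ _) _.
have -> : n`!%:R * c ^+ n = \sum_(s : 'S_n) c ^+ n.
  by rewrite sumr_const card_Sn mulr_natl.
apply: ler_sum => s _; rewrite normrM normrX normrN1 expr1n mul1r normr_prod.
have -> : c ^+ n = \prod_(i < n) c by rewrite prodr_const card_ord.
by apply: ler_prod => i _; rewrite normr_ge0 Hc.
Qed.

Lemma pos_def_ge0 n (G : 'M[int]_n) x : pos_def G -> 0 <= bform G x x.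
Proof.
case=> _ Gpos; have [->|x0] := eqVneq x 0; last exact: ltW (Gpos _ x0).
by rewrite /bform !mul0mx mxE.
Qed.

(** Positivity on sums and differences of two rows bounds the off-diagonal entries by the mean of
    two diagonal ones, hence by the trace. *)
Lemma gram_det_bound m n (G : 'M[int]_n) (M : 'M[int]_(m, n)) (H : 'M[int]_m) :
  pos_def G -> H = M *m G *m M^T -> `|\det H| <= m`!%:R * \tr H ^+ m.
Proof.
move=> Gpos HE; have HG i j : H i j = bform G (row i M) (row j M).
  by rewrite HE bform_mul.
have diag_ge0 i : 0 <= H i i by rewrite HG pos_def_ge0.
have diag_le i : H i i <= \tr H.
  by rewrite /mxtrace (bigD1 i) //= lerDl sumr_ge0.
apply: det_bound => i j; have [GT _] := Gpos.
have Hsym : bform G (row j M) (row i M) = bform G (row i M) (row j M) by rewrite bformC.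
have := pos_def_ge0 (row i M + row j M) Gpos.
have := pos_def_ge0 (row i M - row j M) Gpos.
rewrite !(bformDl, bformDr, bformNl, bformNr) Hsym -!HG.
by have := diag_le i; have := diag_le j; lia.
Qed.

(** * Binary forms and their scalings *)

Lemma det_mx2 (R : comNzRingType) (A : 'M[R]_2) :
  \det A = A 0 0 * A 1 1 - A 0 1 * A 1 0.
Proof.
rewrite (expand_det_row _ 0) !big_ord_recl big_ord0 /cofactor !det_mx11 !mxE /=.
have -> : lift 0 (0 : 'I_1) = 1 :> 'I_2 by apply: val_inj.
have -> : lift 1 (0 : 'I_1) = 0 :> 'I_2 by apply: val_inj.
rewrite /= ?(expr0, expr1); ring.
Qed.

Lemma bform2 (R : comNzRingType) (A : 'M[R]_2) u : A^T = A ->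
  A 0 0 * bform A u u = (A 0 0 * u 0 0 + A 0 1 * u 0 1) ^+ 2 + \det A * u 0 1 ^+ 2.
Proof.
move=> AT; have A10 : A 1 0 = A 0 1 by rewrite -[in LHS]AT mxE.
rewrite det_mx2 bformE !big_ord_recl !big_ord0.
have -> : lift ord0 ord0 = 1 :> 'I_2 by apply: val_inj.
rewrite -[ord0]/(0 : 'I_2) A10; ring.
Qed.

Lemma pos_def2 (A : 'M[int]_2) : pos_def A -> 0 < A 0 0 /\ 0 < \det A.
Proof.
case=> AT Apos; have A0 : 0 < A 0 0.
  rewrite -(bform_delta A 0 0); apply: Apos.
  by apply/eqP => /rowP/(_ 0); rewrite !mxE.
(* The vector is chosen to annihilate the completed square, leaving only the determinant term. *)
split=> //; pose u : 'rV[int]_2 := \row_i (if i == 0 then - A 0 1 else A 0 0).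
have : 0 < A 0 0 * bform A u u.
  rewrite mulr_gt0 //; apply: Apos; apply/eqP => /rowP/(_ 1); rewrite !mxE /= => E.
  by rewrite E ltxx in A0.
rewrite bform2 // !mxE /=.
have -> : (A 0 0 * - A 0 1 + A 0 1 * A 0 0) ^+ 2 + \det A * A 0 0 ^+ 2
  = \det A * A 0 0 ^+ 2 by ring.
by rewrite pmulr_lgt0 // exprn_gt0.
Qed.

(** The form is anisotropic modulo [p]: completing the square, a zero would make [- \det A] a
    square, and [A 0 0] is a unit because otherwise [- \det A] would be the square of [A 0 1]. *)
Lemma dvd_of_dvd_bform2 (A : 'M[int]_2) p u :
  A^T = A -> prime p -> odd p -> legendre (- \det A) p = -1 ->
  (p %| bform A u u)%Z -> exists w, u = p%:Z *: w.
Proof.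
move=> AT pp po lA pu; apply: red_eq0 => //.
have nsq := legendre_nonsquare _ pp po lA.
have detE : ((- \det A)%:~R : 'F_p) = - (\det A)%:~R by rewrite rmorphN.
have [x Ex] : exists x, x = A 0 0 * u 0 0 + A 0 1 * u 0 1 by eexists.
have := congr1 (intr : int -> 'F_p) (bform2 u AT); rewrite -Ex.
rewrite rmorphM /= (_ : (bform A u u)%:~R = 0 :> 'F_p) ?mulr0; last first.
  by apply/eqP; rewrite Fp_intr_eq0.
rewrite !expr2 rmorphD !rmorphM /= -!expr2 => /esym E.
set X := x%:~R in E; set Y := (u 0 1)%:~R in E.
have [XY|nz] := eqVneq (X, Y) (0, 0); last first.
  have [sq _] := neg_square_of_norm_eq0 E nz.
  by have := nsq (X / Y); rewrite sq detE eqxx.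
case: XY => X0 Y0; have A0 : ((A 0 0)%:~R : 'F_p) != 0.
  apply/negP => /eqP a0; have := nsq (A 0 1)%:~R; rewrite detE det_mx2.
  have -> : A 1 0 = A 0 1 by rewrite -[in LHS]AT mxE.
  by rewrite rmorphB !rmorphM /= a0 mul0r sub0r opprK -expr2 eqxx.
have U0 : ((u 0 0)%:~R : 'F_p) = 0.
  move: X0; rewrite /X Ex rmorphD !rmorphM /= -/Y Y0 mulr0 addr0 => /eqP.
  by rewrite mulf_eq0 (negPf A0) => /eqP.
apply/rowP => i; rewrite !mxE.
by case: i => [[|[]]] // ilt; [rewrite -[RHS]U0|rewrite -[RHS]Y0 /Y];
  congr (intr (u _ _)); apply: val_inj.
Qed.

(** Infinite descent: [u = p w], then [v = p t], and the pair [w], [t] solves the same equation with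
    a smaller norm. *)
Lemma scaled_form_disjoint (A : 'M[int]_2) p u v :
  pos_def A -> prime p -> odd p -> legendre (- \det A) p = -1 ->
  bform A u u = p%:Z * bform A v v -> u = 0 /\ v = 0.
Proof.
move=> Ap pp po lA; have [AT Apos] := Ap.
have p1 := prime_gt1 pp; have p0 := prime_gt0 pp.
suff main k : forall u v, `|bform A u u|%N = k -> bform A u u = p%:Z * bform A v v -> u = 0.
  move=> E; have u0 := main _ u v erefl E; split=> //.
  have [//|/Apos vpos] := eqVneq v 0; move: E; rewrite u0 /bform !mul0mx mxE => /esym/eqP.
  by rewrite mulf_eq0 eqz_nat -(negbK (p == 0)%N) -lt0n p0 (gt_eqF vpos).
elim/ltn_ind: k => k IH {}u {}v Ek E.
have [|w uw] := @dvd_of_dvd_bform2 A p u AT pp po lA; first by rewrite E dvdz_mulr.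
have pz : p%:Z != 0 by rewrite eqz_nat -lt0n.
have Ew : bform A v v = p%:Z * bform A w w.
  by apply: (mulfI pz); rewrite -E uw bformZl bformZr.
have [|t vt] := @dvd_of_dvd_bform2 A p v AT pp po lA; first by rewrite Ew dvdz_mulr.
have Et : bform A w w = p%:Z * bform A t t.
  by apply: (mulfI pz); rewrite -Ew vt bformZl bformZr.
have [//|u0] := eqVneq u 0.
suff w0 : w = 0 by rewrite uw w0 scaler0.
apply: (IH `|bform A w w|%N) Et => //.
rewrite -Ek uw bformZl bformZr mulrA abszM ltn_Pmull //; first by rewrite abszM /=; nia.
rewrite absz_gt0; apply: contraNneq u0 => w0.
have [w00|/Apos] := eqVneq w 0; first by rewrite uw w00 scaler0.
by rewrite w0 ltxx.
Qed.

(** A square root is at most [|D|] in absolute value, so a bounded search makes the property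
    boolean. *)
Definition is_square (D : int) : bool := [exists s : 'I_`|D|.+1, D == (s : nat)%:Z ^+ 2].

Lemma is_squareP (D s : int) : D = s ^+ 2 -> is_square D.
Proof.
move=> Ds; have lt : (`|s| < `|D|.+1)%N by rewrite ltnS Ds abszX; nia.
by apply/existsP; exists (Ordinal lt) => /=; rewrite abszE real_normK ?num_real // {1}Ds.
Qed.

Lemma nonresidue_prime D N : ~~ is_square D ->
  exists p : nat, [/\ prime p, odd p, (N < p)%N & legendre D p = -1].
Proof.
case: D => d nsq; last by rewrite NegzE; exact: nonresidue_prime_of_neg.
have d0 : (0 < d)%N.
  by rewrite lt0n; apply: contraNneq nsq => ->; exact: (@is_squareP 0 0).
apply: nonresidue_prime_of_nonsquare => // s ds; case/negP: nsq.
by apply: (@is_squareP _ s%:Z); rewrite ds -mulnn PoszM expr2.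
Qed.

Lemma nonresidue_primes (Ds : seq int) N :
  exists ps : seq nat, [/\ uniq ps,
    {in ps, forall p, [/\ prime p, odd p & (N < p)%N]} &
    {in Ds, forall D, ~~ is_square D -> exists2 p, p \in ps & legendre D p = -1}].
Proof.
elim: Ds => [|D Ds [ps [ups psP psD]]]; first by exists [::].
have [sq|nsq] := boolP (is_square D).
  by exists ps; split=> // D'; rewrite inE => /predU1P[->|/psD//]; rewrite sq.
have [p [pp po Np pl]] := nonresidue_prime N nsq.
have [pin|pnin] := boolP (p \in ps).
  exists ps; split=> // D'; rewrite inE => /predU1P[-> _|/psD//].
  by exists p.
exists (p :: ps); split; first by rewrite /= pnin.
  by move=> q; rewrite inE => /predU1P[->|/psP].
move=> D'; rewrite inE => /predU1P[-> _|D'in nsq'].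
  by exists p; rewrite ?mem_head.
by have [q qin ql] := psD _ D'in nsq'; exists q; rewrite // inE qin orbT.
Qed.

Lemma prime_dvd_prod (ps : seq nat) q : prime q -> {in ps, forall p, prime p} ->
  (q %| \prod_(p <- ps) p)%N -> q \in ps.
Proof.
move=> qp; elim: ps => [|p ps IH] psP.
  by rewrite big_nil dvdn1 => /eqP q1; rewrite q1 in qp.
rewrite big_cons Euclid_dvdM //; case/orP => [|qps].
  by rewrite (dvdn_prime2 qp (psP p (mem_head p ps))) => /eqP ->; exact: mem_head.
by rewrite inE IH ?orbT // => r rin; apply: psP; rewrite inE rin orbT.
Qed.

Lemma prime_sqr_ndvd_prod (ps : seq nat) q :
  prime q -> uniq ps -> {in ps, forall p, prime p} ->
  ~~ (q ^ 2 %| \prod_(p <- ps) p)%N.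
Proof.
move=> qp ups psP; apply/negP => q2.
have qin : q \in ps by apply: prime_dvd_prod => //; apply: dvdn_trans q2; exact: dvdn_exp.
move: q2; rewrite (perm_big _ (perm_to_rem qin)) big_cons /= -mulnn dvdn_pmul2l ?prime_gt0 //.
move/(prime_dvd_prod qp); rewrite mem_rem_uniq // inE eqxx /=.
suff psP' : {in rem q ps, forall p, prime p} by move/(_ psP').
by move=> p /mem_rem /psP.
Qed.

Lemma coprime_fact_prime n p : prime p -> (n < p)%N -> coprime n`! p.
Proof.
move=> pp; elim: n => [|n IH] np; first by rewrite coprime1n.
rewrite factS coprimeMl IH ?(ltnW np) // andbT coprime_sym prime_coprime //.
by apply/negP => /dvdn_leq; lia.
Qed.

Definition diag2 (a b : int) : 'M[int]_2 := diag_mx (\row_i nth 0 [:: a; b] i).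

Lemma bform_diag2 a b u : bform (diag2 a b) u u = a * u 0 0 ^+ 2 + b * u 0 1 ^+ 2.
Proof.
rewrite bformE !big_ord_recl !big_ord0 !mxE /=.
have -> : lift ord0 ord0 = 1 :> 'I_2 by apply: val_inj.
rewrite -[ord0]/(0 : 'I_2); ring.
Qed.

Lemma pos_def_diag2 a b : 0 < a -> 0 < b -> pos_def (diag2 a b).
Proof.
move=> a0 b0; split=> [|u u0]; first by rewrite /diag2 tr_diag_mx.
have [u1|u1] := eqVneq (u 0 1) 0.
  have [u00|u00] := eqVneq (u 0 0) 0.
    case/eqP: u0; apply/rowP => i; rewrite mxE.
    by case: i => [[|[]]] // ilt; [rewrite -[RHS]u00|rewrite -[RHS]u1];
      congr (u _ _); apply: val_inj.
  by rewrite bform_diag2 u1 expr0n mulr0 addr0 mulr_gt0 // exprn_even_gt0.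
rewrite bform_diag2; apply: ltr_wpDl; first by rewrite mulr_ge0 ?sqr_ge0 // ltW.
by rewrite mulr_gt0 // exprn_even_gt0.
Qed.

Lemma pos_def_scale n (A : 'M[int]_n) a : 0 < a -> pos_def A -> pos_def (a *: A).
Proof.
move=> a0 [AT Apos]; split=> [|u u0]; first by rewrite linearZ /= AT.
by rewrite /bform -scalemxAr -scalemxAl mxE mulr_gt0 // Apos.
Qed.

Lemma bform_rep m n (G : 'M[int]_n) (S : 'M[int]_(m, n)) u v :
  bform (S *m G *m S^T) u v = bform G (u *m S) (v *m S).
Proof. by rewrite /bform trmx_mul !mulmxA. Qed.

(** A relation between the rows of [S] and of [T] would give a common norm, so [M] is nonsingular.
    Hence [\det G] is at most the Gram determinant of these rows, which the traces control. *)
Lemma disjoint_det_bound m k (A : 'M[int]_m) (B : 'M[int]_k) (G : 'M[int]_(m + k))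
    (S : 'M[int]_(m, m + k)) (T : 'M[int]_(k, m + k)) :
  pos_def G -> A = S *m G *m S^T -> B = T *m G *m T^T ->
  (forall u v, bform A u u = bform B v v -> u = 0 /\ v = 0) ->
  \det G != 0 /\ `|\det G| <= (m + k)`!%:R * (\tr A + \tr B) ^+ (m + k).
Proof.
move=> Gpos AE BE disj; set M := col_mx S T.
have HE : \det (M *m G *m M^T) = \det M ^+ 2 * \det G.
  by rewrite !det_mulmx det_tr; ring.
have trE : \tr (M *m G *m M^T) = \tr A + \tr B.
  rewrite mul_col_mx tr_col_mx mul_col_row mxtrace_block -AE -BE //.
have dM : \det M != 0.
  apply/det0P => -[v v0]; rewrite -[v]hsubmxK mul_row_col => /eqP.
  rewrite addr_eq0 => /eqP E; case/negP: v0; rewrite -[v]hsubmxK.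
  have [|-> ->] := disj (lsubmx v) (rsubmx v); last by rewrite row_mx0.
  by rewrite AE BE !bform_rep E bformNl bformNr opprK.
have dG : \det G != 0.
  apply/det0P => -[v v0 vG]; have [_ /(_ v v0)] := Gpos.
  by rewrite /bform vG mul0mx mxE ltxx.
split=> //; rewrite -trE.
apply: le_trans (gram_det_bound Gpos (erefl (M *m G *m M^T))).
rewrite HE normrM ler_peMl // normrX exprn_ege1 //.
by rewrite -gtz0_ge1 normr_gt0.
Qed.

Lemma legendre_neg_of_dvdS e p : prime p -> odd p -> (p %| e.+1)%N ->
  legendre (- e%:Z) p = 1.
Proof.
move=> pp po pe; apply: (legendre_sqr pp po (x := 1)); last exact: oner_neq0.
have : ((e.+1%:Z)%:~R : 'F_p) == 0 by rewrite Fp_intr_eq0.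
by rewrite expr1n intS rmorphD rmorph1 rmorphN /= addr_eq0 => /eqP.
Qed.

Lemma obstruction_form (C K : nat) : exists P e : nat,
  [/\ (0 < P)%N, (K < e)%N &
    forall (G : 'M[int]_4) x y, pos_def G -> \det G != 0 -> (`|\det G| <= C)%N ->
      bform G x x = P -> bform G y y = P%:Z * e%:Z -> bform G x y = 0 -> False].
Proof.
(* All possible values of [\det G]. *)
pose Ds : seq int := [seq k%:Z | k <- iota 0 C.+1] ++ [seq - k%:Z | k <- iota 0 C.+1].
have [ps [ups psP psD]] := nonresidue_primes Ds C.
(* Making [e] equal to -1 modulo [8 * C!] gives [e = 7] modulo 8 and [- e = 1] modulo every prime up
   to [C]. *)
have M0 : (0 < 8 * C`!)%N by rewrite muln_gt0 fact_gt0.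
have psM : {in ps, forall p, [/\ prime p, odd p & coprime (8 * C`!) p]}.
  move=> p /psP[pp po Cp]; split=> //.
  by rewrite coprimeMl coprime_fact_prime // -[8%N]/(2 ^ 3)%N coprime_pexpl // coprime2n po.
have [e [Ke Me eps]] := crt_nonresidues K M0 ups psM.
have ps_prime : {in ps, forall p, prime p} by move=> p /psP[].
set P := (\prod_(p <- ps) p)%N.
have P0 : (0 < P)%N by rewrite /P big_seq prodn_cond_gt0 // => p /ps_prime /prime_gt0.
exists P, e; split=> // G x y Gpos D0 DC xx yy xy.
have e8 : (e %% 8 = 7)%N.
  have : (8 %| e.+1)%N by apply: dvdn_trans Me; exact: dvdn_mulr.
  by clear; lia.
have nps p : p \in ps -> ~~ (p %| e)%N.
  move=> pin; apply/negP => pe; have := eps p pin; have [pp _ _] := psP p pin.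
  by rewrite /legendre Fp_intr_eq0 // abszN pe.
have [sq|nsq] := boolP (is_square (\det G)).
  have [s /eqP Ds'] := existsP sq.
  apply: (@square_det_obstruction G s%:Z P Gpos Ds' P0 _ e x y e8) => //.
  - by move=> p pp; exact: prime_sqr_ndvd_prod.
  - by move=> p pp pP; apply: nps; exact: prime_dvd_prod.
  move=> p pp ps'.
  have pC : (p <= C)%N.
    have s0 : (0 < s)%N by rewrite lt0n; apply: contraNneq D0 => s0; rewrite Ds' s0.
    apply: leq_trans DC; rewrite Ds' abszX; apply: leq_trans (dvdn_leq s0 ps') _.
    by rewrite absz_nat -{1}[nat_of_ord s]muln1 -mulnn leq_mul2l s0 orbT.
  have pe : (p %| e.+1)%N.
    by apply: dvdn_trans Me; rewrite dvdn_mull // dvdn_fact // prime_gt0.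
  split=> [|po]; last exact: legendre_neg_of_dvdS.
  apply/negP => pe'; have := prime_gt1 pp.
  have := coprime_dvdl pe' (coprime_dvdr pe (coprimenS e)).
  by rewrite /coprime gcdnn => /eqP ->.
have Din : \det G \in Ds.
  rewrite mem_cat; apply/orP; case: (\det G) DC => k kC; [left|right].
    by apply/mapP; exists k; rewrite // mem_iota.
  by apply/mapP; exists k.+1; rewrite ?mem_iota // NegzE.
have [p pin pl] := psD _ Din nsq.
have [pp po _] := psP p pin.
have [GT _] := Gpos.
have PE : P = (p * \prod_(q <- rem p ps) q)%N.
  by rewrite /P (perm_big _ (perm_to_rem pin)) big_cons.
apply: (@nonsquare_det_obstruction G p (\prod_(q <- rem p ps) q)%N%:Z e%:Z x y) => //.
- exact: eps.
- apply/negP => pQ; have := prime_sqr_ndvd_prod pp ups ps_prime; rewrite -/P PE.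
  by rewrite -mulnn dvdn_pmul2l ?prime_gt0 // => /negP; apply; exact: pQ.
- by rewrite xx PE PoszM.
by rewrite yy PE PoszM.
Qed.

(** [B] is a fixed multiple of [A], chosen before [K]; letting [K] grow varies only the diagonal
    form. *)
Lemma scaled_companion (A : 'M[int]_2) : pos_def A ->
  exists2 B : 'M[int]_2, pos_def B & forall K : nat, exists P e : nat,
    [/\ (0 < P)%N, (K < e)%N &
      forall (G : 'M[int]_4) (S T U : 'M[int]_(2, 4)), pos_def G ->
        A = S *m G *m S^T -> B = T *m G *m T^T ->
        diag2 P (P%:Z * e%:Z) = U *m G *m U^T -> False].
Proof.
move=> Apos; have [_ dA] := pos_def2 Apos.
have dAE : \det A = `|\det A|%N by rewrite gtz0_abs.
have [|p [pp po _ pl]] := @nonresidue_prime_of_neg `|\det A|%N 0.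
  by rewrite absz_gt0 gt_eqF.
rewrite -dAE in pl.
exists (p%:Z *: A) => [|K]; first by apply: pos_def_scale => //; rewrite ltz_nat prime_gt0.
pose c : int := 4`!%:R * (\tr A + \tr (p%:Z *: A)) ^+ 4.
have [P [e [P0 Ke obs]]] := obstruction_form `|c|%N K.
exists P, e; split=> // G S T U Gpos SE TE UE.
have [|D0 Dc] := @disjoint_det_bound 2 2 A (p%:Z *: A) G S T Gpos SE TE.
  move=> u v E; apply: (scaled_form_disjoint Apos pp po pl).
  by rewrite E /bform -scalemxAr -scalemxAl mxE.
have diagE i j : bform G (row i U) (row j U) = diag2 P (P%:Z * e%:Z) i j.
  by rewrite UE bform_mul.
apply: (obs G (row 0 U) (row 1 U)) => //; rewrite ?diagE ?mxE //.
by rewrite -lez_nat abszE (le_trans Dc) // abszE ler_norm.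
Qed.

(** A bound for the norms of the vectors of one basis of [L]. It depends on the representative and
    not only on the isometry class, which suffices for a finite list of representatives. *)
Definition basis_norm_sum (L : zlattice) : nat :=
  (\sum_(j < dim L) `|zform L (r2v (delta_mx 0%R j)) (r2v (delta_mx 0%R j))|)%N.

(* An isometry must send some basis vector off the first axis of [<P, P e>],
   and vectors off this axis have norm at least [e]. *)
Lemma isometric_diag2_bound (L : zlattice) (P e : nat)
    (Dpos : pos_def (diag2 P (P%:Z * e%:Z))) : (0 < P)%N ->
  isometric L (gram_lattice Dpos) -> (e <= basis_norm_sum L)%N.
Proof.
move=> P0 [s [[t sK tK] sE]]; rewrite leqNgt; apply/negP => small.
have s01 j : (s (r2v (delta_mx 0 j)) : 'rV[int]_2) 0 1 = 0.
  set b := r2v _; apply/eqP; apply: contraLR small => nz; rewrite -leqNgt.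
  apply: leq_trans (_ : `|zform L b b| <= _)%N; last first.
    by rewrite /basis_norm_sum (bigD1 j) //= leq_addr.
  rewrite -sE /= /gram_form bform_diag2.
  move: nz; set u := _ 0 0; set v := _ 0 1 => v0.
  have v2 : 1 <= v ^+ 2 by rewrite -gtz0_ge1 exprn_even_gt0.
  have u2 : 0 <= u ^+ 2 by exact: sqr_ge0.
  rewrite -lez_nat abszE; apply: le_trans (ler_norm _).
  have -> : P%:Z * u ^+ 2 + P%:Z * e%:Z * v ^+ 2 =
      e%:Z + (e%:Z * (v ^+ 2 - 1) + (P%:Z - 1) * (e%:Z * v ^+ 2) + P%:Z * u ^+ 2) by ring.
  have v2' : 0 <= v ^+ 2 := sqr_ge0 v.
  by rewrite lerDl !addr_ge0 // mulr_ge0 ?subr_ge0 // mulr_ge0.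
have s01' x : (s x : 'rV[int]_2) 0 1 = 0.
  rewrite -[x]v2rK [v2r x]row_sum_delta !linear_sum /= summxE big1 // => j _.
  by rewrite !linearZ /= mxE s01 mulr0.
by have := s01' (t (delta_mx 0 1)); rewrite tK mxE.
Qed.

Lemma pos_def_block m n (A : 'M[int]_m) (B : 'M[int]_n) :
  pos_def A -> pos_def B -> pos_def (block_mx A 0 0 B).
Proof.
move=> Apos Bpos; have [AT Ap] := Apos; have [BT Bp] := Bpos.
split=> [|x x0]; first by rewrite tr_block_mx AT BT !trmx0.
have -> : bform (block_mx A 0 0 B) x x =
    bform A (lsubmx x) (lsubmx x) + bform B (rsubmx x) (rsubmx x).
  rewrite /bform -{1 2}[x]hsubmxK mul_row_block !mulmx0 addr0 add0r.
  by rewrite tr_row_mx mul_row_col mxE.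
have [l0|/Ap l0] := eqVneq (lsubmx x) 0; last by rewrite ltr_pwDl // pos_def_ge0.
rewrite ltr_wpDl ?pos_def_ge0 // Bp //; apply: contraNneq x0 => r0.
by rewrite -[x]hsubmxK l0 r0 row_mx0.
Qed.

Lemma two_lattices_representable m n (l l' : zlattice) : rank l = m -> rank l' = n ->
  exists L, [/\ rank L = (m + n)%N, represents L l & represents L l'].
Proof.
move=> /gram_of_exists[A gA] /gram_of_exists[B gB].
have Gpos := pos_def_block (gram_pos_def gA) (gram_pos_def gB).
exists (gram_lattice Gpos); split; first exact: rank_gram_lattice.
  apply/(represents_gram (gram_of_lattice Gpos) gA); exists (row_mx 1%:M 0).
  rewrite mul_row_block tr_row_mx mul_row_col !trmx1 !trmx0.
  by rewrite !(mul1mx, mulmx1, mul0mx, mulmx0, addr0).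
apply/(represents_gram (gram_of_lattice Gpos) gB); exists (row_mx 0 1%:M).
rewrite mul_row_block tr_row_mx mul_row_col !trmx1 !trmx0.
by rewrite !(mul1mx, mulmx1, mul0mx, mulmx0, add0r).
Qed.

Lemma infinitely_many_obstructing_pairs (l : zlattice) : rank l = 2%N ->
  infinitely_many_up_to isometric_pairs
    (fun p : zlattice * zlattice =>
      [/\ rank p.1 = 2%N, rank p.2 = 2%N &
        ~ exists L : zlattice,
          [/\ rank L = 4%N, represents L l, represents L p.1 & represents L p.2]]).
Proof.
move=> /gram_of_exists[A gA] [n [s sP]].
have [B Bpos obs] := scaled_companion (gram_pos_def gA).
(* Taking [e] beyond the bounds of all listed second components makes the new diagonal lattice
   isometric to none of them. *)
have [P [e [P0 Ke none]]] := obs (\sum_(i < n) basis_norm_sum (s i).2)%N.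
have Dpos : pos_def (diag2 P (P%:Z * e%:Z)).
  have e0 : (0 < e)%N by exact: leq_ltn_trans Ke.
  by apply: pos_def_diag2; rewrite -?PoszM ltz_nat ?muln_gt0 ?P0.
have [|i [_ iso]] := sP (gram_lattice Bpos, gram_lattice Dpos).
  split; rewrite ?rank_gram_lattice //.
  case=> L [/gram_of_exists[G gG]] /(represents_gram gG gA)[S SE].
  move=> /(represents_gram gG (gram_of_lattice Bpos))[T TE].
  move=> /(represents_gram gG (gram_of_lattice Dpos))[U UE].
  exact: none (gram_pos_def gG) SE TE UE.
have := isometric_diag2_bound P0 iso; rewrite leqNgt => /negP; apply.
by apply: leq_trans Ke; rewrite ltnS (bigD1 i) //= leq_addr.
Qed.

Local Close Scope ring_scope.

Theorem theorem3p3 :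
  (forall l : zlattice, rank l = 2 ->
     infinitely_many_up_to isometric_pairs
       (fun p : zlattice * zlattice =>
          [/\ rank p.1 = 2, rank p.2 = 2 &
              ~ exists L : zlattice,
                  [/\ rank L = 4, represents L l, represents L p.1
                    & represents L p.2]]))
  /\ is_kappa 2 4 2.
Proof.
split; first exact: infinitely_many_obstructing_pairs.
split=> [l rl|k sim].
  have [L [rL L0 L1]] := two_lattices_representable (rl ord0) (rl ord_max).
  exists L; split=> // i.
  by have [->|->] : i = ord0 \/ i = ord_max
    by case: i => [[|[|]]] // ilt; [left|right]; apply: val_inj.
rewrite leqNgt; apply/negP => k2.
have Ipos : pos_def (diag2 1%R 1%R) by exact: pos_def_diag2.
pose l := gram_lattice Ipos; have rl : rank l = 2 := rank_gram_lattice Ipos.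
apply: (infinitely_many_obstructing_pairs rl).
(* The empty list of representatives: if every triple were representable, no pair would be
   obstructing. *)
exists 0%N, (fun=> (l, l)) => -[l1 l2] /= [r1 r2 none]; exfalso; apply: none.
(* Indices beyond 2 repeat [l2], so any [k] above 2 is refuted by a triple. *)
pose f (i : 'I_k) : zlattice := if i == 0 :> nat then l else if i == 1 :> nat then l1 else l2.
have [i|L [rL repL]] := sim f; first by rewrite /f; do 2 case: ifP => // _.
exists L; split=> //.
- exact: (repL (Ordinal (ltn_trans (ltn0Sn 1) k2))).
- exact: (repL (Ordinal (ltnW k2))).
exact: (repL (Ordinal k2)).
Qed.
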